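(* Let $\mathcal{C}$ be an essentially small triangulated category and let $\mathcal{A}\subset\mathcal{C}$ be the heart of a bounded $t$-structure such that $\mathcal{A}$, and every heart obtained from $\mathcal{A}$ by a finite sequence of simple tilts, has finite length and only finitely many indecomposable objects (up to isomorphism). Let $s_1,\ldots,s_k$ be distinct simple objects of $\mathcal{A}$, let $\mathcal{B}$ be the heart of a bounded $t$-structure on $\mathcal{C}$, and suppose that $$S_{\{s_1,\ldots,s_k\}}\subset U(\mathcal{A})\cap\overline{U(\mathcal{B})}.$$ Then $\mathcal{B}=L_{\mathcal{T}}\mathcal{A}$ for some torsion theory $\mathcal{T}$ in $\mathcal{A}$ with $\mathcal{T}\subset\langle s_1,\ldots,s_k\rangle$.
   Context: Subcategories are strict and full. $\langle S\rangle$ denotes the extension-closed subcategory generated by $S$. A $t$-structure on $\mathcal{C}$ is a subcategory $\mathcal{D}$ with $\mathcal{D}[1]\subset\mathcal{D}$ such that every $c\in\mathcal{C}$ fits in an exact triangle $d\to c\to d'\to d[1]$ with $d\in\mathcal{D}$, $d'\in\mathcal{D}^\perp=\{c : \mathrm{Hom}(d,c)=0\ \forall d\in\mathcal{D}\}$; its heart is the abelian category $\mathcal{D}\cap\mathcal{D}^\perp[1]$; it is bounded if every object lies in $\mathcal{D}[-n]\cap\mathcal{D}^\perp[n]$ for some $n\in\mathbb{N}$. All $t$-structures are assumed bounded; a bounded $t$-structure is determined by its heart. A torsion theory in an abelian category $\mathcal{A}$ is a subcategory $\mathcal{T}$ such that every $a\in\mathcal{A}$ fits in a short exact sequence $0\to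 t\to a\to f\to 0$ with $t\in\mathcal{T}$ and $f\in\mathcal{F}:=\mathcal{T}^\perp$ (orthogonal in $\mathcal{A}$). If $\mathcal{A}$ is a heart, the left tilt at $\mathcal{T}$ is the heart $L_{\mathcal{T}}\mathcal{A}=\langle\mathcal{F},\mathcal{T}[-1]\rangle$ and the right tilt is the heart $R_{\mathcal{T}}\mathcal{A}=\langle\mathcal{F}[1],\mathcal{T}\rangle$. For $s\in\mathcal{A}$ simple (with $\mathcal{A}$ of finite length and with finitely many simples), $L_s\mathcal{A}:=L_{\langle s\rangle}\mathcal{A}$ and $R_s\mathcal{A}:=R_{{}^\perp\langle s\rangle}\mathcal{A}$, where ${}^\perp\langle s\rangle=\{a\in\mathcal{A}:\mathrm{Hom}(a,s')=0\ \forall s'\in\langle s\rangle\}$; these are the simple (left, right) tilts of $\mathcal{A}$. A stability condition $\sigma=(\mathcal{Z},\mathcal{P})$ on $\mathcal{C}$ (Bridgeland) consists of a homomorphism $\mathcal{Z}:K(\mathcal{C})\to\mathbb{C}$ (central charge) and full additive subcategories $\mathcal{P}(\varphi)$, $\varphi\in\mathbb{R}$ (semi-stables of phase $\varphi$), with: nonzero $c\in\mathcal{P}(\varphi)$ has $\mathcal{Z}(c)=m(c)e^{i\pi\varphi}$, $m(c)>0$; $\mathcal{P}(\varphi+1)=\mathcal{P}(\varphi)[1]$; $\mathrm{Hom}(c,c')=0$ for $c\in\mathcal{P}(\varphi)$, $c'\in\mathcal{P}(\varphi')$, $\varphi>\varphi'$; and every nonzero $c$ has a finite filtration by triangles with semi-stable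 factors of strictly decreasing phases $\varphi_1>\cdots>\varphi_n$. Put $\varphi_\sigma^+(c)=\varphi_1$, $\varphi_\sigma^-(c)=\varphi_n$, and let $m_\sigma(c)$ be the sum of the masses $m$ of the factors. Its heart is the extension-closed subcategory generated by semi-stables with phases in $(0,1]$. $\mathrm{Stab}(\mathcal{C})$ is the space of locally-finite stability conditions (for some $\epsilon>0$ every quasi-abelian category $\mathcal{P}(t-\epsilon,t+\epsilon)$ has finite length), with the topology of the generalised metric $d(\sigma,\tau)=\sup_{c\neq0}\max(|\varphi_\sigma^-(c)-\varphi_\tau^-(c)|,|\varphi_\sigma^+(c)-\varphi_\tau^+(c)|,|\log(m_\sigma(c)/m_\tau(c))|)$. $U(\mathcal{A})\subset\mathrm{Stab}(\mathcal{C})$ is the subset of locally-finite stability conditions with heart $\mathcal{A}$, and bars denote closures in $\mathrm{Stab}(\mathcal{C})$. $S_{\{s_1,\ldots,s_k\}}\subset U(\mathcal{A})$ is the set of $\sigma\in U(\mathcal{A})$ for which $s_1,\ldots,s_k$ have phase $1$ and all other simples of $\mathcal{A}$ have phases in $(0,1)$. *)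

(* Defs.v *)
From HB Require Import structures.
From mathcomp Require Import all_boot all_order all_algebra generic_quotient ring_quotient.
From mathcomp Require Import freeg.
From mathcomp Require Import all_classical all_reals all_analysis.
From mathcomp Require Import complex.

Set Implicit Arguments.
Unset Strict Implicit.
Unset Printing Implicit Defensive.

Import Order.TTheory GRing.Theory Num.Theory.
Import numFieldNormedType.Exports.

Local Open Scope classical_set_scope.
Local Open Scope ring_scope.

Declare Scope cat_scope.
Delimit Scope cat_scope with cat.
Local Open Scope quotient_scope.
Local Open Scope cat_scope.

(* The type of objects lives in a fixed universe, so the isomorphism classes
   of objects always form a (small) type: essential smallness is built in. *)
Record precat := Precat {
  Ob :> Type;
  Hom : Ob -> Ob -> zmodType;
  idm : forall X, Hom X X;
  comp : forall X Y Z, Hom Y Z -> Hom X Y -> Hom X Z;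
  compA : forall X Y Z W (h : Hom Z W) (g : Hom Y Z) (f : Hom X Y),
    comp h (comp g f) = comp (comp h g) f;
  comp1m : forall X Y (f : Hom X Y), comp (idm Y) f = f;
  compm1 : forall X Y (f : Hom X Y), comp f (idm X) = f;
  compDl : forall X Y Z (g g' : Hom Y Z) (f : Hom X Y),
    comp (g + g') f = comp g f + comp g' f;
  compDr : forall X Y Z (g : Hom Y Z) (f f' : Hom X Y),
    comp g (f + f') = comp g f + comp g f'
}.

Arguments Hom {p}.
Arguments idm {p}.
Arguments comp {p X Y Z}.

Notation "g \o f" := (comp g f) : cat_scope.

Section Preadditive.
Variable C : precat.
Implicit Types X Y Z : C.

Definition is_iso X Y (f : Hom X Y) :=
  exists g : Hom Y X, g \o f = idm X /\ f \o g = idm Y.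

Definition isomorphic X Y := exists f : Hom X Y, is_iso f.

Definition is_zero X := idm X = 0.

Definition is_biproduct X Y S :=
  exists (i : Hom X S) (j : Hom Y S) (p : Hom S X) (q : Hom S Y),
    [/\ p \o i = idm X, q \o j = idm Y, p \o j = 0, q \o i = 0
      & (i \o p) + (j \o q) = idm S].

End Preadditive.

(* The shift is an additive autoequivalence, i.e. fully faithful and
   essentially surjective; it need not be invertible on objects. *)
Record triangulated := Triangulated {
  tcat :> precat;
  has_zero : exists Z : tcat, is_zero Z;
  has_biproducts : forall X Y : tcat, exists S, is_biproduct X Y S;
  shift : tcat -> tcat;
  shiftm : forall X Y : tcat, Hom X Y -> Hom (shift X) (shift Y);
  shiftm1 : forall X : tcat, shiftm (idm X) = idm (shift X);
  shiftmM : forall (X Y Z : tcat) (g : Hom Y Z) (f : Hom X Y),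
    shiftm (g \o f) = shiftm g \o shiftm f;
  shiftmD : forall (X Y : tcat) (f g : Hom X Y),
    shiftm (f + g) = shiftm f + shiftm g;
  shiftm_bij : forall X Y : tcat, bijective (@shiftm X Y);
  shift_ess : forall Y : tcat, exists X, isomorphic Y (shift X);
  dist : forall X Y Z : tcat, Hom X Y -> Hom Y Z -> Hom Z (shift X) -> Prop;
  (* TR1 *)
  dist_iso : forall (X Y Z X' Y' Z' : tcat)
      (f : Hom X Y) (g : Hom Y Z) (h : Hom Z (shift X))
      (f' : Hom X' Y') (g' : Hom Y' Z') (h' : Hom Z' (shift X'))
      (u : Hom X X') (v : Hom Y Y') (w : Hom Z Z'),
    is_iso u -> is_iso v -> is_iso w ->
    f' \o u = v \o f -> g' \o v = w \o g -> h' \o w = shiftm u \o h ->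
    dist f g h -> dist f' g' h';
  dist_id : forall X Z : tcat, is_zero Z ->
    dist (idm X) (0 : Hom X Z) (0 : Hom Z (shift X));
  dist_complete : forall (X Y : tcat) (f : Hom X Y),
    exists Z (g : Hom Y Z) (h : Hom Z (shift X)), dist f g h;
  (* TR2 *)
  dist_rot : forall (X Y Z : tcat)
      (f : Hom X Y) (g : Hom Y Z) (h : Hom Z (shift X)),
    dist f g h <-> dist g h (- shiftm f);
  (* TR3 *)
  dist_morph : forall (X Y Z X' Y' Z' : tcat)
      (f : Hom X Y) (g : Hom Y Z) (h : Hom Z (shift X))
      (f' : Hom X' Y') (g' : Hom Y' Z') (h' : Hom Z' (shift X'))
      (u : Hom X X') (v : Hom Y Y'),
    dist f g h -> dist f' g' h' -> f' \o u = v \o f ->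
    exists w : Hom Z Z', g' \o v = w \o g /\ h' \o w = shiftm u \o h;
  (* TR4, the octahedral axiom *)
  dist_octa : forall (X Y Z U V W : tcat)
      (f : Hom X Y) (f1 : Hom Y U) (f2 : Hom U (shift X))
      (g : Hom Y Z) (g1 : Hom Z W) (g2 : Hom W (shift Y))
      (h1 : Hom Z V) (h2 : Hom V (shift X)),
    dist f f1 f2 -> dist g g1 g2 -> dist (g \o f) h1 h2 ->
    exists (a : Hom U V) (b : Hom V W),
      [/\ dist a b (shiftm f1 \o g2), a \o f1 = h1 \o g, h2 \o a = f2,
          b \o h1 = g1 & g2 \o b = shiftm f \o h2]
}.

Arguments shift {t}.
Arguments shiftm {t X Y}.
Arguments dist {t X Y Z}.

(* A strict full subcategory is an isomorphism-closed set of objects. *)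

Section Subcategories.
Variable C : triangulated.
Implicit Types (X Y Z : C) (D P A T : set C).

Definition iso_closed D := forall X Y, isomorphic X Y -> D X -> D Y.

(* D[1] and D[-1] *)
Definition shift_up D : set C := [set Y | exists2 X, D X & isomorphic Y (shift X)].
Definition shift_down D : set C := [set X | D (shift X)].

(* D^perp and ^perp D; both are taken in C, and the orthogonals in a full
   subcategory A are their intersections with A *)
Definition orthr D : set C := [set Y | forall X, D X -> forall f : Hom X Y, f = 0].
Definition orthl D : set C := [set X | forall Y, D Y -> forall f : Hom X Y, f = 0].

Inductive ext_closure (S : set C) : C -> Prop :=
| ext_gen X : S X -> ext_closure S X
| ext_zero X : is_zero X -> ext_closure S X
| ext_iso X Y : isomorphic X Y -> ext_closure S X -> ext_closure S Y
| ext_tri X Y Z (f : Hom X Y) (g : Hom Y Z) (h : Hom Z (shift X)) :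
    dist f g h -> ext_closure S X -> ext_closure S Z -> ext_closure S Y.

(* The following notions are relative to the full subcategory on P. *)
Definition mono_in P X Y (f : Hom X Y) :=
  forall W, P W -> forall g h : Hom W X, f \o g = f \o h -> g = h.

Definition is_kernel_in P X Y Z (f : Hom X Y) (g : Hom Y Z) :=
  g \o f = 0 /\
  forall W, P W -> forall u : Hom W Y, g \o u = 0 -> exists! v : Hom W X, u = f \o v.

Definition is_cokernel_in P X Y Z (f : Hom X Y) (g : Hom Y Z) :=
  g \o f = 0 /\
  forall W, P W -> forall u : Hom Y W, u \o f = 0 -> exists! v : Hom Z W, u = v \o g.

Definition short_exact_in P X Y Z (f : Hom X Y) (g : Hom Y Z) :=
  [/\ P X, P Y, P Z, is_kernel_in P f g & is_cokernel_in P f g].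

(* strict monomorphisms are the kernels; in an abelian category these are
   all the monomorphisms *)
Definition strict_mono_in P X Y (f : Hom X Y) :=
  exists Z (g : Hom Y Z), P Z /\ is_kernel_in P f g.

Definition sub_le X X' Y (f : Hom X Y) (f' : Hom X' Y) :=
  exists u : Hom X X', f = f' \o u.

(* chains of strict subobjects stabilise *)
Definition artinian P := forall Y, P Y ->
  forall (S : nat -> C) (i : forall n, Hom (S n) Y),
    (forall n, P (S n) /\ strict_mono_in P (i n)) ->
    (forall n, sub_le (i n.+1) (i n)) ->
    exists N, forall n, (N <= n)%N -> sub_le (i n) (i n.+1).

Definition noetherian P := forall Y, P Y ->
  forall (S : nat -> C) (i : forall n, Hom (S n) Y),
    (forall n, P (S n) /\ strict_mono_in P (i n)) ->
    (forall n, sub_le (i n) (i n.+1)) ->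
    exists N, forall n, (N <= n)%N -> sub_le (i n.+1) (i n).

Definition finite_length P := artinian P /\ noetherian P.

Definition simple_in A X :=
  [/\ A X, ~ is_zero X
    & forall Y (f : Hom Y X), A Y -> mono_in A f -> is_zero Y \/ is_iso f].

Definition indecomposable_in A X :=
  [/\ A X, ~ is_zero X
    & forall Y Z, A Y -> A Z -> is_biproduct Y Z X -> is_zero Y \/ is_zero Z].

Definition finitely_many_indecomposables A :=
  exists (n : nat) (x : 'I_n -> C),
    forall X, indecomposable_in A X -> exists i, isomorphic X (x i).

Definition t_structure D :=
  [/\ iso_closed D, shift_up D `<=` D
    & forall c, exists (d d' : C) (f : Hom d c) (g : Hom c d') (h : Hom d' (shift d)),
        [/\ dist f g h, D d & orthr D d']].

Definition heart D : set C := D `&` shift_up (orthr D).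

Definition bounded D := forall c, exists n : nat,
  (iter n shift_down D `&` iter n shift_up (orthr D)) c.

Definition is_heart A := exists D, [/\ t_structure D, bounded D & A = heart D].

Definition torsion_theory A T :=
  [/\ T `<=` A, iso_closed T
    & forall a, A a -> exists (t f : C) (i : Hom t a) (p : Hom a f),
        [/\ short_exact_in A i p, T t & orthr T f]].

Definition left_tilt A T : set C :=
  ext_closure ((A `&` orthr T) `|` shift_down T).

Definition right_tilt A T : set C :=
  ext_closure (shift_up (A `&` orthr T) `|` T).

Definition simple_left_tilt A s : set C :=
  left_tilt A (ext_closure [set s]).

Definition simple_right_tilt A s : set C :=
  right_tilt A (A `&` orthl (ext_closure [set s])).

Inductive simple_tilts A : set C -> Prop :=
| simple_tilts0 : simple_tilts A A
| simple_tiltsL B s : simple_tilts A B -> simple_in B s ->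
    simple_tilts A (simple_left_tilt B s)
| simple_tiltsR B s : simple_tilts A B -> simple_in B s ->
    simple_tilts A (simple_right_tilt B s).

End Subcategories.

Section Grothendieck.
Variable C : triangulated.

Definition free_ob := {freeg {classic C} / int}.

Definition gen_ob (X : C) : free_ob := << (X : {classic C}) >>.

(* the subgroup generated by [Y] - [X] - [Z], for X -> Y -> Z -> X[1] exact *)
Inductive k0_rel : free_ob -> Prop :=
| k0_rel0 : k0_rel 0
| k0_relB x y : k0_rel x -> k0_rel y -> k0_rel (x - y)
| k0_rel_tri (X Y Z : C) (f : Hom X Y) (g : Hom Y Z) (h : Hom Z (shift X)) :
    dist f g h -> k0_rel (gen_ob Y - gen_ob X - gen_ob Z).

Definition k0_pred : {pred free_ob} := fun x => `[< k0_rel x >].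

Fact k0_pred_zmod_closed : zmod_closed k0_pred.
Proof.
split; first by apply/asboolP; exact: k0_rel0.
by move=> x y /asboolP hx /asboolP hy; apply/asboolP; exact: k0_relB.
Qed.

HB.instance Definition _ := GRing.isZmodClosed.Build free_ob k0_pred k0_pred_zmod_closed.

Definition K0 : zmodType := Quotient.quot k0_pred.

Definition k0_class (X : C) : K0 := \pi_(Quotient.quot k0_pred) (gen_ob X).

End Grothendieck.

Section Stability.
Variables (R : realType) (C : triangulated).
Local Open Scope complex_scope.

(* exp (i * pi * phi) *)
Definition expipi (phi : R) : R[i] := cos (pi * phi) +i* sin (pi * phi).

(* Harder-Narasimhan filtrations: [hn P c s] holds when c has a filtration
   0 = c_0 -> ... -> c_n = c whose successive cones are nonzero objects a_i of
   P(phi_i), with phi_1 > ... > phi_n and s = [:: (phi_1, a_1); ...; (phi_n, a_n)].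
   The zero objects have the empty filtration. *)
Inductive hn (P : R -> set C) : C -> seq (R * C) -> Prop :=
| hn0 c : is_zero c -> hn P c [::]
| hnS c' c a s (phi : R) (f : Hom c' c) (g : Hom c a) (h : Hom a (shift c')) :
    hn P c' s -> dist f g h -> P phi a -> ~ is_zero a ->
    all (fun x => phi < x.1) s -> hn P c (rcons s (phi, a)).

Record stability := Stability {
  central_charge : {additive K0 C -> R[i]};
  slice : R -> set C;
  slice_iso : forall phi, iso_closed (slice phi);
  slice_zero : forall phi X, is_zero X -> slice phi X;
  slice_biproduct : forall phi X Y S,
    is_biproduct X Y S -> slice phi X -> slice phi Y -> slice phi S;
  slice_charge : forall phi c, slice phi c -> ~ is_zero c ->
    exists2 m : R, 0 < m & central_charge (k0_class c) = m%:C * expipi phi;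
  slice_shift : forall phi, slice (phi + 1) = shift_up (slice phi);
  slice_hom : forall phi psi c c', psi < phi -> slice phi c -> slice psi c' ->
    forall f : Hom c c', f = 0;
  slice_hn : forall c, exists s, hn slice c s
}.

Definition slice_on (s : stability) (I : set R) : set C :=
  ext_closure [set X | exists2 phi, I phi & slice s phi X].

Definition stability_heart (s : stability) : set C := slice_on s `]0, 1].

Definition locally_finite (s : stability) := exists2 e : R, 0 < e &
  forall t : R, finite_length (slice_on s `](t - e), (t + e)[).

Record Stab := MkStab { stab_val :> stability; stab_lf : locally_finite stab_val }.

Implicit Types s t : Stab.

(* a Harder-Narasimhan filtration of c, unique up to isomorphism *)
Definition hn_of s (c : C) : seq (R * C) := projT1 (cid (slice_hn s c)).

Definition phase_max s c : R := head 0 (unzip1 (hn_of s c)).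
Definition phase_min s c : R := last 0 (unzip1 (hn_of s c)).

(* a nonzero semistable a has Z(a) = m(a) exp (i * pi * phi) with m(a) > 0,
   so that m(a) = |Z(a)| *)
Definition mass s c : R :=
  \sum_(x <- hn_of s c) Normc.normc (central_charge s (k0_class x.2)).

Definition stab_gap s t (c : C) : R :=
  Num.max `|phase_min s c - phase_min t c|
    (Num.max `|phase_max s c - phase_max t c| `|ln (mass s c / mass t c)|).

(* The supremum may be infinite, and is -oo when C = 0. *)
Definition stab_dist s t : \bar R :=
  ereal_sup [set (stab_gap s t c)%:E | c in [set c | ~ is_zero c]].

Fact expipi_normc phi : Normc.normc (expipi phi) = 1.
Proof. by rewrite /expipi /Normc.normc cos2Dsin2 sqrtr1. Qed.

Fact hn_mass (s : stability) c L : hn (slice s) c L ->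
  (L = [::] /\ is_zero c) \/
  0 < \sum_(x <- L) Normc.normc (central_charge s (k0_class x.2)).
Proof.
elim=> [{}c c0|c' {}c a L' phi f g h _ IH _ Pa a0 _]; first by left.
right; rewrite big_rcons/= ltr_wpDl//.
  by case: IH => [[-> _]|/ltW//]; rewrite big_nil.
have [m m0 ->] := slice_charge Pa a0.
rewrite Normc.normcM expipi_normc mulr1 /Normc.normc /= expr0n addr0 sqrtr_sqr.
by rewrite gtr0_norm.
Qed.

Fact mass_gt0 s c : ~ is_zero c -> 0 < mass s c.
Proof. by move=> c0; case: (hn_mass (projT2 (cid (slice_hn s c)))) => // -[_ /c0]. Qed.

Fact stab_gap_sym s t c : stab_gap s t c = stab_gap t s c.
Proof.
rewrite /stab_gap distrC (distrC (phase_max s c)) -[in RHS]invf_div.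
have [z|z] := eqVneq (mass s c / mass t c) 0.
  by rewrite z invr0.
case: (ltgtP 0 (mass s c / mass t c)) z => // [z _|z _].
  by rewrite lnV ?posrE// normrN.
by rewrite !ln0 ?invr_le0 ?ltW.
Qed.

Fact stab_gap_triangle s t u c : ~ is_zero c ->
  stab_gap s u c <= stab_gap s t c + stab_gap t u c.
Proof.
move=> c0; have [sc tc uc] := And3 (mass_gt0 s c0) (mass_gt0 t c0) (mass_gt0 u c0).
rewrite /stab_gap !ge_max; apply/and3P; split.
- apply: le_trans (ler_distD (phase_min t c) _ _) _.
  by rewrite lerD// le_max lexx.
- apply: le_trans (ler_distD (phase_max t c) _ _) _.
  by rewrite lerD// !le_max lexx orbT.
- rewrite !ln_div ?posrE//; apply: le_trans (ler_distD (ln (mass t c)) _ _) _.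
  by rewrite lerD// !le_max lexx !orbT.
Qed.

Fact stab_dist_center s (e : R) : 0 < e -> (stab_dist s s < e%:E)%E.
Proof.
move=> e0; apply: (@le_lt_trans _ _ 0%E); last by rewrite lte_fin.
apply: ub_ereal_sup => _ [c c0 <-]; rewrite lee_fin /stab_gap !subrr normr0.
by rewrite divff ?ln1 ?normr0 ?maxxx// gt_eqF// mass_gt0.
Qed.

Fact stab_dist_sym s t : stab_dist s t = stab_dist t s.
Proof. by rewrite /stab_dist; congr ereal_sup; apply: eq_imagel => c _; rewrite stab_gap_sym. Qed.

Fact stab_dist_triangle s t u (e1 e2 : R) :
  (stab_dist s t < e1%:E -> stab_dist t u < e2%:E ->
   stab_dist s u < (e1 + e2)%:E)%E.
Proof.
move=> st tu.
have [[c0 c00]|nc] := pselect (exists c : C, ~ is_zero c); last first.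
  rewrite /stab_dist (_ : [set c | _] = set0) ?image_set0 ?ereal_sup0 ?ltNyr//.
  by apply/seteqP; split=> // c c0; apply: nc; exists c.
have gle s' t' c : ~ is_zero c -> ((stab_gap s' t' c)%:E <= stab_dist s' t')%E.
  by move=> cn; apply: ereal_sup_ubound; exists c.
have fin s' t' e : (stab_dist s' t' < e%:E)%E -> stab_dist s' t' \is a fin_num.
  move=> h; rewrite fin_numE; apply/andP; split.
    by rewrite gt_eqF// (lt_le_trans _ (gle s' t' _ c00))// ltNyr.
  by rewrite lt_eqF// (lt_trans h)// ltry.
apply: (@le_lt_trans _ _ (stab_dist s t + stab_dist t u)%E); last first.
  by rewrite EFinD lteD.
apply: ub_ereal_sup => _ [c cn <-].
apply: (@le_trans _ _ ((stab_gap s t c)%:E + (stab_gap t u c)%:E)%E).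
  by rewrite -EFinD lee_fin stab_gap_triangle.
by rewrite leeD// gle.
Qed.

Definition stab_ball s (e : R) : set Stab := [set t | (stab_dist s t < e%:E)%E].

Definition stab_ent : set_system (Stab * Stab) := entourage_ stab_ball.

Fact stab_ball_center s (e : R) : 0 < e -> stab_ball s e s.
Proof. exact: stab_dist_center. Qed.

Fact stab_ball_sym s t (e : R) : stab_ball s e t -> stab_ball t e s.
Proof. by rewrite /stab_ball/= stab_dist_sym. Qed.

Fact stab_ball_triangle s t u (e1 e2 : R) :
  stab_ball s e1 t -> stab_ball t e2 u -> stab_ball s (e1 + e2) u.
Proof. exact: stab_dist_triangle. Qed.

HB.instance Definition _ := gen_eqMixin Stab.
HB.instance Definition _ := gen_choiceMixin Stab.
HB.instance Definition _ := hasNbhs.Build Stab (nbhs_ stab_ent).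
HB.instance Definition _ := @Nbhs_isPseudoMetric.Build R Stab
  stab_ent erefl stab_ball stab_ball_center stab_ball_sym stab_ball_triangle erefl.

(* U(A) *)
Definition stab_with_heart (A : set C) : set Stab :=
  [set s | stability_heart s = A].

(* S_{s_1, ..., s_k}; the other simple objects are those not isomorphic to any
   of s_1, ..., s_k *)
Definition stab_stratum (A : set C) (k : nat) (x : 'I_k -> C) : set Stab :=
  [set s | [/\ stab_with_heart A s,
     forall i, slice s 1 (x i)
   & forall y, simple_in A y -> (forall i, ~ isomorphic y (x i)) ->
       exists2 phi, 0 < phi < 1 & slice s phi y]].

End Stability.

(* Main.v *)
(* A stability condition on C with heart A is determined by a charge on the
   Grothendieck group of A, here Z = - p + i q where p counts the composition
   factors isomorphic to some s_i and q the others. It lies in the stratum, and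
   it is locally finite because only finitely many phases occur in (0, 1], those
   of indecomposable objects. That such a sigma is a limit of stability
   conditions tau with heart B gives, for the aisles D_A and D_B of the two
   t-structures, D_A <= D_B <= D_A[-1]: an object is in the aisle exactly when
   its minimal phase is positive, and minimal phases of sigma and tau are
   uniformly close. Hence B is the left tilt of A at T, the intersection of A
   and D_B[1], and objects of T have sigma-phase 1, i.e. q = 0, so that all
   their composition factors are among the s_i.

   The charge is extended from A to C by alternating sums over cohomology; their
   additivity on triangles is shown by devissage with the octahedral axiom. *)
From HB Require Import structures.
Require Import Defs.
From mathcomp Require Import all_boot all_order all_algebra.
From mathcomp Require Import generic_quotient ring_quotient freeg.
From mathcomp Require Import all_classical all_reals all_analysis.
From mathcomp Require Import ring lra zify complex.
Import Defs.

Set Implicit Arguments.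
Unset Strict Implicit.
Unset Printing Implicit Defensive.

Import Order.TTheory GRing.Theory Num.Theory.

Local Open Scope classical_set_scope.
Local Open Scope ring_scope.
Local Open Scope cat_scope.

(** * Triangulated categories *)

(** The inclusion is assumed for every point of the stratum but says nothing if the stratum is
    empty, so most of the work goes into building one point. Its charge is integral: the quotients
    of a given object realise only finitely many charges, hence one of minimal phase exists. Phases
    are compared through the sign of the real number [theta], which is additive on triangles. The
    heart is never packaged as an abelian category. Its short exact sequences are triangles with all
    three vertices in the heart, images come from [heart_image], and the isomorphism theorems are
    instances of the octahedral axiom. As the shift is invertible only up to isomorphism, most
    statements concern triangles up to isomorphism of their vertices. *)

Section Preadditive.
Variable C : precat.
Implicit Types X Y Z W : C.

Lemma comp0m X Y Z (f : Hom X Y) : (0 : Hom Y Z) \o f = 0.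
Proof. by apply: (@addIr _ (0 \o f)); rewrite -compDl !add0r. Qed.

Lemma compm0 X Y Z (g : Hom Y Z) : g \o (0 : Hom X Y) = 0.
Proof. by apply: (@addIr _ (g \o 0)); rewrite -compDr !add0r. Qed.

Lemma compNm X Y Z (g : Hom Y Z) (f : Hom X Y) : (- g) \o f = - (g \o f).
Proof. by apply: (@addIr _ (g \o f)); rewrite -compDl !addNr comp0m. Qed.

Lemma compmN X Y Z (g : Hom Y Z) (f : Hom X Y) : g \o (- f) = - (g \o f).
Proof. by apply: (@addIr _ (g \o f)); rewrite -compDr !addNr compm0. Qed.

Lemma compBl X Y Z (g g' : Hom Y Z) (f : Hom X Y) :
  (g - g') \o f = (g \o f) - (g' \o f).
Proof. by rewrite compDl compNm. Qed.

Lemma compBr X Y Z (g : Hom Y Z) (f f' : Hom X Y) :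
  g \o (f - f') = (g \o f) - (g \o f').
Proof. by rewrite compDr compmN. Qed.

Lemma is_iso_id X : is_iso (idm X).
Proof. by exists (idm X); rewrite comp1m. Qed.

Lemma is_iso_comp X Y Z (g : Hom Y Z) (f : Hom X Y) :
  is_iso g -> is_iso f -> is_iso (g \o f).
Proof.
move=> [g' [g'g gg']] [f' [f'f ff']]; exists (f' \o g'); split.
  by rewrite -compA (compA g') g'g comp1m.
by rewrite -compA (compA f) ff' comp1m.
Qed.

Lemma isomorphic_refl X : isomorphic X X.
Proof. by exists (idm X); exact: is_iso_id. Qed.

Lemma isomorphic_sym X Y : isomorphic X Y -> isomorphic Y X.
Proof. by move=> [f [g [gf fg]]]; exists g, f. Qed.

Lemma isomorphic_trans Y X Z :
  isomorphic X Y -> isomorphic Y Z -> isomorphic X Z.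
Proof. by move=> [f fi] [g gi]; exists (g \o f); exact: is_iso_comp. Qed.

Lemma hom_to_zero X Z (f : Hom X Z) : is_zero Z -> f = 0.
Proof. by move=> Z0; rewrite -(comp1m f) Z0 comp0m. Qed.

Lemma hom_from_zero X Z (f : Hom Z X) : is_zero Z -> f = 0.
Proof. by move=> Z0; rewrite -(compm1 f) Z0 compm0. Qed.

Lemma is_zero_iso X Y : isomorphic X Y -> is_zero X -> is_zero Y.
Proof.
by move=> [f [g [gf fg]]] X0; rewrite /is_zero -fg (hom_to_zero g X0) compm0.
Qed.

Lemma is_zero_isomorphic X Y : is_zero X -> is_zero Y -> isomorphic X Y.
Proof. by move=> X0 Y0; exists 0, 0; rewrite !comp0m X0 Y0. Qed.

(* If [n = e - 1] has square zero then [e] is invertible with inverse [1 - n]. *)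
Lemma is_iso_unipotent X (n : Hom X X) : n \o n = 0 -> is_iso (idm X + n).
Proof.
move=> nn; exists (idm X - n).
by rewrite compBl compDl !compDr !compmN nn !comp1m !compm1 oppr0 !addr0 addrK subrK.
Qed.

Lemma iso_of_left_right X Y (u : Hom X Y) (v v' : Hom Y X) :
  is_iso (v \o u) -> is_iso (u \o v') -> is_iso u.
Proof.
move=> [a [a1 _]] [b [_ b1]].
have lu : (a \o v) \o u = idm X by rewrite -compA.
have ur : u \o (v' \o b) = idm Y by rewrite compA.
exists (a \o v); split=> //.
suff -> : a \o v = v' \o b by [].
by rewrite -[LHS]compm1 -ur compA lu comp1m.
Qed.

End Preadditive.

Section Triangulated.
Variable C : triangulated.
Implicit Types X Y Z W : C.

Lemma shiftm0 X Y : shiftm (0 : Hom X Y) = 0.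
Proof. by apply: (@addIr _ (shiftm 0)); rewrite -shiftmD !add0r. Qed.

Lemma shiftmN X Y (f : Hom X Y) : shiftm (- f) = - shiftm f.
Proof. by apply: (@addIr _ (shiftm f)); rewrite -shiftmD !addNr shiftm0. Qed.

Lemma shiftm_inj X Y : injective (@shiftm C X Y).
Proof. exact: bij_inj (shiftm_bij X Y). Qed.

Lemma shiftm_surj X Y (g : Hom (shift X) (shift Y)) : exists f, g = shiftm f.
Proof. by have [h _ hK] := shiftm_bij X Y; exists (h g); rewrite hK. Qed.

Lemma shift_iso X Y : isomorphic X Y <-> isomorphic (shift X) (shift Y).
Proof.
split=> [] [f [g [gf fg]]].
  by exists (shiftm f), (shiftm g); rewrite -!shiftmM gf fg !shiftm1.
have [f' Ef] := shiftm_surj f; have [g' Eg] := shiftm_surj g.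
exists f', g'; split; apply: shiftm_inj; rewrite shiftmM shiftm1.
  by rewrite -Ef -Eg.
by rewrite -Ef -Eg.
Qed.

Lemma is_zero_shift X : is_zero (shift X) <-> is_zero X.
Proof.
rewrite /is_zero; split=> h; first by apply: shiftm_inj; rewrite shiftm1 h shiftm0.
by rewrite -shiftm1 h shiftm0.
Qed.

Section Exactness.
Variables (X Y Z : C) (f : Hom X Y) (g : Hom Y Z) (h : Hom Z (shift X)).
Hypothesis T : dist f g h.

Lemma dist_comp0 : g \o f = 0.
Proof.
have [N N0] := has_zero C.
have [ |w [E _]] := dist_morph (u := idm X) (v := f) (dist_id X N0) T.
  by rewrite compm1.
by rewrite E compm0.
Qed.

(** Exactness of [Hom(W, -)]: TR3 is applied to the rotated triangle [W -> 0 -> W[1]], and the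
    resulting map between shifts is desuspended by fullness. *)
Lemma dist_lift W (u : Hom W Y) : g \o u = 0 -> exists v, u = f \o v.
Proof.
have [N N0] := has_zero C => gu.
have T0 := (dist_rot _ _ _).1 (dist_id W N0).
have T1 := (dist_rot _ _ _).1 T.
have [ |w [_ E]] := dist_morph (u := u) (v := 0 : Hom N Z) T0 T1.
  by rewrite compm0.
have [v Ev] := shiftm_surj w; exists v.
apply: shiftm_inj; apply: oppr_inj.
by rewrite shiftmM -Ev -compNm E shiftm1 compmN compm1.
Qed.

Lemma dist_factor W (u : Hom Y W) : u \o f = 0 -> exists v, u = v \o g.
Proof.
have [N N0] := has_zero C => uf.
have SO0 := (is_zero_shift N).2 N0.
have T0 : dist (0 : Hom N W) (idm W) (0 : Hom W (shift N)).
  by apply/dist_rot; rewrite shiftm0 oppr0; apply: dist_id.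
have [ |w [E _]] := dist_morph (u := 0 : Hom X N) (v := u) T T0.
  by rewrite compm0.
by exists w; rewrite -E comp1m.
Qed.

End Exactness.

Section Exactness2.
Variables (X Y Z : C) (f : Hom X Y) (g : Hom Y Z) (h : Hom Z (shift X)).
Hypothesis T : dist f g h.

Let T1 := (dist_rot _ _ _).1 T.
Let T2 := (dist_rot _ _ _).1 T1.

Lemma dist_comp0s : shiftm f \o h = 0.
Proof. by apply: oppr_inj; rewrite -compNm oppr0; exact: dist_comp0 T2. Qed.

Lemma dist_lift_h W (u : Hom W Z) : h \o u = 0 -> exists v, u = g \o v.
Proof. exact: dist_lift T1 _ _. Qed.

Lemma dist_factor_h W (u : Hom Z W) : u \o g = 0 -> exists v, u = v \o h.
Proof. exact: dist_factor T1 _ _. Qed.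

Lemma dist_lift_s W (u : Hom W X) :
  f \o u = 0 -> exists v : Hom (shift W) Z, shiftm u = h \o v.
Proof.
move=> fu; apply: (dist_lift T2).
by rewrite compNm -shiftmM fu shiftm0 oppr0.
Qed.

Lemma dist_iso_zero : is_iso f -> is_zero Z.
Proof.
move=> [k [kf fk]].
have g0 : g = 0 by rewrite -(compm1 g) -fk compA (dist_comp0 T) comp0m.
have h0 : h = 0.
  by rewrite -(comp1m h) -shiftm1 -kf shiftmM -compA dist_comp0s compm0.
have [v] : exists v, idm Z = g \o v by apply: dist_lift_h; rewrite h0 comp0m.
by rewrite g0 comp0m.
Qed.

Lemma dist_zero_iso : is_zero Z -> is_iso f.
Proof.
move=> Z0; have [|v E] := dist_lift T (u := idm Y).
  by rewrite (hom_to_zero g Z0) comp0m.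
exists v; split=> //; apply/eqP; rewrite -subr_eq0; apply/eqP.
have [|w Ew] := dist_lift_s (u := (v \o f) - idm X).
  by rewrite compBr compm1 compA -E comp1m subrr.
by apply: shiftm_inj; rewrite Ew (hom_to_zero w Z0) compm0 shiftm0.
Qed.

End Exactness2.

(** The difference [e - 1] kills [g], so it factors through [h]; as [h] also kills [e - 1], its
    square is zero. *)
Lemma dist_endo_iso X Y Z (f : Hom X Y) (g : Hom Y Z) (h : Hom Z (shift X))
    (e : Hom Z Z) :
  dist f g h -> e \o g = g -> h \o e = h -> is_iso e.
Proof.
move=> T eg he.
have [|k Ek] := dist_factor_h T (u := e - idm Z).
  by rewrite compBl eg comp1m subrr.
have -> : e = idm Z + (e - idm Z) by rewrite addrC subrK.
apply: is_iso_unipotent.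
by rewrite {1}Ek -compA compBr he compm1 subrr compm0.
Qed.

(** The maps that TR3 gives in the two directions need not be mutually inverse, but both composites
    are endomorphisms as in [dist_endo_iso]. *)
Lemma dist_morph_iso X Y Z X' Y' Z'
    (f : Hom X Y) (g : Hom Y Z) (h : Hom Z (shift X))
    (f' : Hom X' Y') (g' : Hom Y' Z') (h' : Hom Z' (shift X'))
    (u : Hom X X') (v : Hom Y Y') :
  dist f g h -> dist f' g' h' -> f' \o u = v \o f -> is_iso u -> is_iso v ->
  exists w : Hom Z Z', [/\ is_iso w, g' \o v = w \o g & h' \o w = shiftm u \o h].
Proof.
move=> T T' E [u' [u'u uu']] [v' [v'v vv']].
have E' : f \o u' = v' \o f'.
  by rewrite -[LHS]comp1m -v'v -!compA (compA v) -E -compA uu' compm1.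
have [w [w1 w2]] := dist_morph T T' E.
have [w' [w1' w2']] := dist_morph T' T E'.
exists w; split=> //; apply: (iso_of_left_right (v := w') (v' := w')).
  apply: (dist_endo_iso T).
    by rewrite -compA -w1 compA -w1' -compA v'v compm1.
  by rewrite compA w2' -compA w2 compA -shiftmM u'u shiftm1 comp1m.
apply: (dist_endo_iso T').
  by rewrite -compA -w1' compA -w1 -compA vv' compm1.
by rewrite compA w2 -compA w2' compA -shiftmM uu' shiftm1 comp1m.
Qed.

(** Forgetting the maps makes the relation invariant under isomorphism of each vertex, and
    reversible under rotation and shift. *)
Definition tri X Y Z := exists (f : Hom X Y) (g : Hom Y Z) (h : Hom Z (shift X)),
  dist f g h.

Lemma tri_iso X Y Z X' Y' Z' : isomorphic X X' -> isomorphic Y Y' ->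
  isomorphic Z Z' -> tri X Y Z -> tri X' Y' Z'.
Proof.
move=> [u ui] [v vi] [w wi] [f [g [h T]]].
have [[u' [u1 u2]] [v' [v1 v2]] [w' [w1 w2]]] := And3 ui vi wi.
exists (v \o (f \o u')), (w \o (g \o v')), (shiftm u \o (h \o w')).
apply: (dist_iso ui vi wi _ _ _ T).
- by rewrite -!compA u1 compm1.
- by rewrite -!compA v1 compm1.
- by rewrite -!compA w1 compm1.
Qed.

Lemma tri_rot X Y Z : tri X Y Z -> tri Y Z (shift X).
Proof. by move=> [f [g [h /dist_rot T]]]; do 3!eexists; exact: T. Qed.

Lemma dist_unrot X Y Z (g : Hom Y Z) (h : Hom Z (shift X)) (k : Hom (shift X) (shift Y)) :
  dist g h k -> exists f, dist f g h.
Proof.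
have [f Ef] := shiftm_surj k => T; exists (- f); apply/dist_rot.
by rewrite shiftmN opprK -Ef.
Qed.

Lemma tri_unrot X Y Z : tri Y Z (shift X) -> tri X Y Z.
Proof. by move=> [g [h [k /dist_unrot[f T]]]]; exists f, g, h. Qed.

Lemma tri_shift X Y Z : tri X Y Z <-> tri (shift X) (shift Y) (shift Z).
Proof. by split=> [/tri_rot/tri_rot/tri_rot|/tri_unrot/tri_unrot/tri_unrot]. Qed.

Lemma dist_fibre Y Z (g : Hom Y Z) :
  exists X (f : Hom X Y) (h : Hom Z (shift X)), dist f g h.
Proof.
have [W [a [b T]]] := dist_complete g.
have [X [u ui]] := shift_ess W.
have [u' [u'u uu']] := ui.
have [|f Tf] := @dist_unrot X Y Z g (u \o a) (b \o u').
  apply: (dist_iso (is_iso_id _) (is_iso_id _) ui _ _ _ T).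
  - by rewrite comp1m compm1.
  - by rewrite compm1.
  - by rewrite shiftm1 comp1m -compA u'u compm1.
by exists X, f, (u \o a).
Qed.

Lemma tri_zero1 X Y Z : is_zero X -> isomorphic Y Z -> tri X Y Z.
Proof.
move=> X0 i; apply: tri_unrot.
apply: tri_iso (isomorphic_refl _) i (isomorphic_refl _) _.
do 3!eexists; apply: dist_id; exact/is_zero_shift.
Qed.

Lemma tri_zero3 X Y Z : is_zero Z -> isomorphic X Y -> tri X Y Z.
Proof.
move=> Z0 i; apply: tri_iso (isomorphic_refl _) i (isomorphic_refl _) _.
by do 3!eexists; apply: dist_id.
Qed.

Lemma tri_zero3_iso X Y Z : is_zero Z -> tri X Y Z -> isomorphic X Y.
Proof. by move=> Z0 [f [g [h T]]]; exists f; exact: dist_zero_iso T Z0. Qed.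

Lemma tri_zero1_iso X Y Z : is_zero X -> tri X Y Z -> isomorphic Y Z.
Proof. by move=> X0 /tri_rot; apply: tri_zero3_iso; exact/is_zero_shift. Qed.

Lemma tri_octa X Y Z U W : tri X Y U -> tri Y Z W ->
  exists V, tri X Z V /\ tri U V W.
Proof.
move=> [f [f1 [f2 T]]] [g [g1 [g2 T']]].
have [V [h1 [h2 T'']]] := dist_complete (g \o f).
have [a [b [Tab _ _ _ _]]] := dist_octa T T' T''.
by exists V; split; do 3!eexists; [exact: T''|exact: Tab].
Qed.

(** In a heart, [F] is the preimage in [Y] of the subobject [Z1] of [Z = Y/X]. *)
Lemma tri_octa_fibre X Y Z Z1 Z2 : tri X Y Z -> tri Z1 Z Z2 ->
  exists F, tri F Y Z2 /\ tri X F Z1.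
Proof.
move=> T /tri_rot T'; have [V [T1 T2]] := tri_octa (tri_rot T) T'.
have [F FV] := shift_ess V; exists F; split; apply/tri_unrot.
  exact: tri_iso (isomorphic_refl _) (isomorphic_refl _) FV T1.
by apply/tri_unrot/tri_unrot; apply: tri_iso FV _ T2; exact: isomorphic_refl.
Qed.

(** The retraction [p] of [i] forces [h = 0], so [g] is split by some [r], and [q] induces the
    isomorphism from the cone of [i] to [Y]. *)
Lemma tri_biproduct X Y S : is_biproduct X Y S -> tri X S Y.
Proof.
move=> [i [j [p [q [pi qj pj qi ij]]]]].
have [Q [g [h T]]] := dist_complete i.
have h0 : h = 0.
  by rewrite -(comp1m h) -shiftm1 -pi shiftmM -compA (dist_comp0s T) compm0.
have [|r Er] := dist_lift_h T (u := idm Q); first by rewrite h0 comp0m.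
have [w Ew] := dist_factor T qi.
have wi : is_iso w.
  exists (g \o j); split; last by rewrite compA -Ew.
  have E : ((g \o j) \o w) \o g = g.
    rewrite -compA -Ew -compA.
    have -> : j \o q = idm S - (i \o p) by rewrite -ij addrAC subrr add0r.
    by rewrite compBr compm1 compA (dist_comp0 T) comp0m subr0.
  by rewrite -[LHS]compm1 Er compA E.
apply: (tri_iso (isomorphic_refl X) (isomorphic_refl S) (_ : isomorphic Q Y)).
  by exists w.
by exists i, g, h.
Qed.

End Triangulated.

Arguments isomorphic_refl {C X}.
#[global] Hint Resolve isomorphic_refl : core.

(** * Hearts of t-structures *)

Section Orthogonal.
Variables (C : triangulated) (S : set C).

Lemma orthr_iso : iso_closed (orthr S).
Proof.
move=> X Y [f [g [_ fg]]] oX W SW u.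
by rewrite -(comp1m u) -fg -compA (oX _ SW (g \o u)) compm0.
Qed.

Lemma orthr_zero X : is_zero X -> orthr S X.
Proof. by move=> X0 W _ f; exact: hom_to_zero. Qed.

Lemma orthr_ext X Y Z : tri X Y Z -> orthr S X -> orthr S Z -> orthr S Y.
Proof.
move=> [f [g [h T]]] oX oZ W SW u.
have [v ->] := dist_lift T (oZ _ SW (g \o u)).
by rewrite (oX _ SW v) compm0.
Qed.

End Orthogonal.

Section TStructure.
Variables (C : triangulated) (D : set C).
Hypothesis hD : t_structure D.
Implicit Types X Y Z W : C.

Let D_iso : iso_closed D. Proof. by case: hD. Qed.

Lemma aisle_shift X : D X -> D (shift X).
Proof. by case: hD => _ + _ DX; apply; exists X. Qed.

Lemma truncation c : exists d d', [/\ tri d c d', D d & orthr D d'].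
Proof.
by case: hD => _ _ /(_ c)[d [d' [f [g [h [T ? ?]]]]]]; exists d, d'; split=> //; exists f, g, h.
Qed.

(** The map from [X] to its truncation [d'] vanishes, so the identity of [d'] factors through
    [d[1]], which lies in [D]; hence [d'] is zero. *)
Lemma aisle_of_orth X :
  (forall Y, orthr D Y -> forall f : Hom X Y, f = 0) -> D X.
Proof.
move=> oX; case: hD => _ _ /(_ X)[d [d' [f [g [h [T Dd od']]]]]].
have g0 : g = 0 by apply: oX.
have [|r Er] := dist_factor_h T (u := idm d').
  by rewrite g0 compm0.
have Z0 : is_zero d'.
  by rewrite /is_zero Er (od' _ (aisle_shift Dd) r) comp0m.
by apply: D_iso Dd; exists f; exact: dist_zero_iso T Z0.
Qed.

Lemma aisle_zero X : is_zero X -> D X.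
Proof. by move=> X0; apply: aisle_of_orth => Y _ f; exact: hom_from_zero. Qed.

Lemma aisle_ext X Y Z : tri X Y Z -> D X -> D Z -> D Y.
Proof.
move=> [f [g [h T]]] DX DZ; apply: aisle_of_orth => W oW u.
have [v ->] := dist_factor T (oW _ DX (u \o f)).
by rewrite (oW _ DZ v) comp0m.
Qed.

Lemma aisle_cone X Y Z : tri X Y Z -> D X -> D Y -> D Z.
Proof. by move=> /tri_rot T /aisle_shift DX DY; exact: aisle_ext T DY DX. Qed.

(** This is [D^perp[1]], written as [D[1]^perp] so that no object has to be desuspended. *)
Definition coaisle : set C := orthr (shift_up D).

Lemma coaisleP X : coaisle X <-> forall W, D W -> forall f : Hom (shift W) X, f = 0.
Proof.
split=> [coX W DW f|oX Y [W DW [f [g [gf fg]]]] u].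
  by apply: coX; exists W.
by rewrite -(compm1 u) -gf compA (oX _ DW (u \o g)) comp0m.
Qed.

Lemma coaisle_shift X : coaisle (shift X) <-> orthr D X.
Proof.
rewrite coaisleP; split=> h W DW f.
  by apply: shiftm_inj; rewrite shiftm0; exact: h.
by have [u ->] := shiftm_surj f; rewrite (h _ DW u) shiftm0.
Qed.

Lemma orthr_coaisle X : orthr D X -> coaisle X.
Proof. by move=> oX; apply/coaisleP => W DW f; apply: oX; exact: aisle_shift. Qed.

Lemma coaisle_fibre X Y Z : tri X Y Z -> coaisle Y -> coaisle Z -> coaisle X.
Proof.
move=> T coY coZ; have [Z' iZ] := shift_ess Z.
have T' : tri Z' X Y by apply/tri_unrot; apply: tri_iso T.
apply: orthr_ext T' _ coY; apply: orthr_coaisle.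
by apply/coaisle_shift; exact: orthr_iso iZ coZ.
Qed.

(** Truncation relative to [D[1]] instead of [D]: for [c] in [D], the term [H] lies in the heart and
    is the top cohomology of [c]. *)
Lemma truncation_shift c : exists V H, [/\ tri (shift V) c H, D V & coaisle H].
Proof.
have [c' ic] := shift_ess c.
have [d [d' [T Dd od']]] := truncation c'.
exists d, (shift d'); split=> //; last exact/coaisle_shift.
by apply: tri_iso (isomorphic_sym ic) _ ((tri_shift _ _ _).1 T).
Qed.

Local Notation A := (heart D).

Lemma heartP X : A X <-> D X /\ coaisle X.
Proof.
split=> [[DX [Y oY iX]]|[DX coX]]; split=> //.
  by apply: orthr_iso (isomorphic_sym iX) _; exact/coaisle_shift.
have [Y iY] := shift_ess X; exists Y => //.
by apply/coaisle_shift; exact: orthr_iso iY coX.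
Qed.

Lemma heart_aisle X : A X -> D X. Proof. by move=> /heartP[]. Qed.

Lemma heart_coaisle X : A X -> coaisle X. Proof. by move=> /heartP[]. Qed.

Lemma heart_iso : iso_closed A.
Proof.
move=> X Y i /heartP[DX coX]; apply/heartP; split; first exact: D_iso i DX.
exact: orthr_iso i coX.
Qed.

Lemma heart_zero X : is_zero X -> A X.
Proof. by move=> X0; apply/heartP; split; [exact: aisle_zero|exact: orthr_zero]. Qed.

Lemma heart_ext X Y Z : tri X Y Z -> A X -> A Z -> A Y.
Proof.
move=> T /heartP[DX coX] /heartP[DZ coZ]; apply/heartP.
by split; [exact: aisle_ext T DX DZ|exact: orthr_ext T coX coZ].
Qed.

Lemma shift_heart_hom0 X Y (f : Hom (shift X) Y) : D X -> coaisle Y -> f = 0.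
Proof. by move=> DX /coaisleP; apply. Qed.

Section Short.
Variables (X Y Z : C) (f : Hom X Y) (g : Hom Y Z) (h : Hom Z (shift X)).
Hypothesis T : dist f g h.

(** The obstruction to injectivity is a map [W[1] -> Z], which is zero. *)
Lemma dist_mono W (u : Hom W X) : D W -> coaisle Z -> f \o u = 0 -> u = 0.
Proof.
move=> DW coZ /(dist_lift_s T)[v Ev].
by apply: shiftm_inj; rewrite Ev (shift_heart_hom0 v DW coZ) compm0 shiftm0.
Qed.

Lemma dist_epi W (u : Hom Z W) : D X -> coaisle W -> u \o g = 0 -> u = 0.
Proof.
by move=> DX coW /(dist_factor_h T)[v ->]; rewrite (shift_heart_hom0 v DX coW) comp0m.
Qed.

Hypotheses (AX : A X) (AY : A Y) (AZ : A Z).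

Lemma heart_dist_mono : mono_in A f.
Proof.
move=> W AW u v E; apply/eqP; rewrite -subr_eq0; apply/eqP.
apply: dist_mono; [exact: heart_aisle|exact: heart_coaisle|].
by rewrite compBr E subrr.
Qed.

Lemma heart_dist_kernel : is_kernel_in A f g.
Proof.
split; first exact: dist_comp0 T.
move=> W AW u gu; have [v Ev] := dist_lift T gu; exists v; split=> // v' Ev'.
by apply: (heart_dist_mono AW); rewrite -Ev.
Qed.

Lemma heart_dist_short_exact : short_exact_in A f g.
Proof.
split=> //; first exact: heart_dist_kernel.
split; first exact: dist_comp0 T.
move=> W AW u uf; have [v Ev] := dist_factor T uf; exists v; split=> // v' Ev'.
apply/eqP; rewrite -subr_eq0; apply/eqP.
apply: dist_epi; [exact: heart_aisle|exact: heart_coaisle|].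
by rewrite compBl -Ev -Ev' subrr.
Qed.

End Short.

Lemma dist_fibre_unique X X' Y Z (f : Hom X Y) (f' : Hom X' Y) (g : Hom Y Z) h h' :
  dist f g h -> dist f' g h' -> isomorphic X X'.
Proof.
move=> /dist_rot T /dist_rot T'.
have E : g \o idm Y = idm Z \o g by rewrite comp1m compm1.
have [w [wi _ _]] := dist_morph_iso T T' E (is_iso_id _) (is_iso_id _).
by apply/shift_iso; exists w.
Qed.

Lemma dist_mono_zero X Y Z (f : Hom X Y) (g : Hom Y Z) h :
  dist f g h -> D X -> coaisle Z -> f = 0 -> is_zero X.
Proof. by move=> T DX coZ f0; apply: (dist_mono T) => //; rewrite f0 comp0m. Qed.

Lemma dist_epi_zero X Y Z (f : Hom X Y) (g : Hom Y Z) h :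
  dist f g h -> D X -> coaisle Z -> g = 0 -> is_zero Z.
Proof. by move=> T DX coZ g0; apply: (dist_epi T) => //; rewrite g0 compm0. Qed.

(* The image [I], kernel [N] and cokernel [Q] come from truncating the cone of
   [f]: it is an extension of [Q] by [N[1]]. *)
Lemma heart_image X Y (f : Hom X Y) : A X -> A Y ->
  exists N I Q (n : Hom N X) (e : Hom X I) h (m : Hom I Y) (q : Hom Y Q) h',
  [/\ [/\ A N, A I & A Q], dist n e h, dist m q h' & f = m \o e].
Proof.
move=> /heartP[DX coX] /heartP[DY coY].
have [K [k [d Tf]]] := dist_complete f.
have [N [Q [[a [b [c TK]]] DN coQ]]] := truncation_shift K.
have [I [m [c2 TI]]] := dist_fibre (b \o k).
have [|e Ee] := dist_lift TI (u := f).
  by rewrite -compA (dist_comp0 Tf) compm0.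
have [E [e1 [e2 Te]]] := dist_complete e.
subst f; have [a' [b' [TE _ _ Eb _]]] := dist_octa Te TI Tf.
(* The octahedron only gives [b' \o k = b \o k]. The difference factors through [X[1]], and
   [Hom(X[1], Q) = 0]. *)
have {Eb} Eb : b' = b.
  have [|v Ev] := dist_factor_h Tf (u := b' - b).
    by rewrite compBl Eb subrr.
  by apply/eqP; rewrite -subr_eq0 Ev (shift_heart_hom0 v DX coQ) comp0m.
rewrite {}Eb in TE.
have [u ui] : isomorphic E (shift N) by exact: dist_fibre_unique TE TK.
have [u' [u'u _]] := ui.
have [|n Tn] := @dist_unrot _ N X I e (u \o e1) (e2 \o u').
  apply: (dist_iso (is_iso_id _) (is_iso_id _) ui _ _ _ Te).
  - by rewrite comp1m compm1.
  - by rewrite compm1.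
  - by rewrite shiftm1 comp1m -compA u'u compm1.
have DI : D I.
  apply: (aisle_ext (Y := I) (X := X) (Z := shift N)) => //; last exact: aisle_shift.
  by exists e, (u \o e1), (- shiftm n); exact: (dist_rot _ _ _).1 Tn.
have coI : coaisle I by apply: (coaisle_fibre (Y := Y) (Z := Q)) => //; do 3!eexists; exact: TI.
have coN : coaisle N by apply: (coaisle_fibre (Y := X) (Z := I)) => //; do 3!eexists; exact: Tn.
have DQ : D Q by apply: (aisle_cone (X := I) (Y := Y)) => //; do 3!eexists; exact: TI.
exists N, I, Q, n, e, (u \o e1), m, (b \o k), c2.
by split=> //; split; apply/heartP.
Qed.

(** The kernel [N] supplied by [heart_image] vanishes, so the monomorphism is its own image and [Q]
    is its cokernel. *)
Lemma heart_mono_dist X Y (f : Hom X Y) : A X -> A Y -> mono_in A f ->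
  exists Q (q : Hom Y Q) h, A Q /\ dist f q h.
Proof.
move=> AX AY fm.
have [N [I [Q [n [e [h [m [q [h' [[AN AI AQ] Tn Tm Ef]]]]]]]]]] := heart_image f AX AY.
have n0 : n = 0.
  apply: (fm _ AN); rewrite compm0 Ef -compA (dist_comp0 Tn) compm0 //.
have N0 : is_zero N.
  exact: dist_mono_zero Tn (heart_aisle AN) (heart_coaisle AI) n0.
have ei : is_iso e.
  by apply: dist_zero_iso ((dist_rot _ _ _).1 Tn) _; exact/is_zero_shift.
have [e' [e'e ee']] := ei.
exists Q, q, (shiftm e' \o h'); split=> //.
apply: (dist_iso (u := e') (v := idm Y) (w := idm Q) _ _ _ _ _ _ Tm) => //;
  try exact: is_iso_id.
- by exists e.
- by rewrite Ef comp1m -compA ee' compm1.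
- by rewrite comp1m compm1.
- by rewrite compm1.
Qed.

Lemma heart_epi_dist X Y (f : Hom X Y) : A X -> A Y ->
  (forall W, A W -> forall u : Hom Y W, u \o f = 0 -> u = 0) ->
  exists N (n : Hom N X) h, A N /\ dist n f h.
Proof.
move=> AX AY fe.
have [N [I [Q [n [e [h [m [q [h' [[AN AI AQ] Tn Tm Ef]]]]]]]]]] := heart_image f AX AY.
have q0 : q = 0.
  by apply: (fe _ AQ); rewrite Ef compA (dist_comp0 Tm) comp0m.
have Q0 : is_zero Q.
  exact: dist_epi_zero Tm (heart_aisle AI) (heart_coaisle AQ) q0.
have mi : is_iso m by exact: dist_zero_iso Tm Q0.
have [m' [m'm mm']] := mi.
exists N, n, (h \o m'); split=> //.
apply: (dist_iso (u := idm N) (v := idm X) (w := m) _ _ _ _ _ _ Tn) => //;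
  try exact: is_iso_id.
- by rewrite comp1m compm1.
- by rewrite compm1 Ef.
- by rewrite shiftm1 comp1m -compA m'm compm1.
Qed.

(** The image of [f] is a nonzero subobject of the simple [Y], hence all of it. *)
Lemma simple_epi_dist X Y (f : Hom X Y) : A X -> simple_in A Y -> f <> 0 ->
  exists N (n : Hom N X) h, A N /\ dist n f h.
Proof.
move=> AX [AY _ sY] f0; apply: heart_epi_dist => // W AW u uf.
have [N [I [Q [n [e [h [m [q [h' [[AN AI AQ] Tn Tm Ef]]]]]]]]]] := heart_image f AX AY.
have [I0|mi] := sY _ m AI (heart_dist_mono Tm AQ).
  by case: f0; rewrite Ef (hom_to_zero e I0) compm0.
have um : u \o m = 0.
  apply: (dist_epi Tn); [exact: heart_aisle|exact: heart_coaisle|].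
  by rewrite -compA -Ef.
by have [m' [_ mm']] := mi; rewrite -(compm1 u) -mm' compA um comp0m.
Qed.

Lemma simple_hom_iso X Y (f : Hom X Y) : simple_in A X -> simple_in A Y ->
  f <> 0 -> is_iso f.
Proof.
move=> [AX X0 sX] sY f0.
have [N [n [h [AN T]]]] := simple_epi_dist AX sY f0.
have [AY _ _] := sY.
have [N0|ni] := sX _ n AN (heart_dist_mono T AY).
  by apply: dist_zero_iso ((dist_rot _ _ _).1 T) _; exact/is_zero_shift.
case: f0; have [n' [_ nn']] := ni.
by rewrite -(compm1 f) -nn' compA (dist_comp0 T) comp0m.
Qed.

End TStructure.

(** * Composition series *)

Section FiniteLength.
Variables (C : triangulated) (D : set C).
Hypothesis hD : t_structure D.
Local Notation A := (heart D).
Hypothesis flA : finite_length A.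
Implicit Types X Y Z W : C.

Lemma heart_mono_strict X Y (f : Hom X Y) : A X -> A Y -> mono_in A f ->
  strict_mono_in A f.
Proof.
move=> AX AY /(heart_mono_dist hD AX AY)[Q [q [h [AQ T]]]].
by exists Q, q; split=> //; exact: heart_dist_kernel T AQ.
Qed.

Lemma mono_in_comp X Y Z (g : Hom Y Z) (f : Hom X Y) (P : set C) :
  mono_in P g -> mono_in P f -> mono_in P (g \o f).
Proof.
by move=> gm fm W PW u v; rewrite -!compA => /(gm _ PW)/(fm _ PW).
Qed.

(** A minimal nonzero subobject is simple; if there were none, dependent choice would give a
    strictly descending chain. *)
Lemma heart_simple_sub a : A a -> ~ is_zero a ->
  exists y Q, [/\ simple_in A y, A Q & tri y a Q].
Proof.
move=> Aa a0.
pose sub := {S : C & Hom S a}.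
pose good (x : sub) := [/\ A (tag x), mono_in A (tagged x) & ~ is_zero (tag x)].
pose le (x y : sub) := sub_le (tagged x) (tagged y).
have [x gx minx] : exists2 x, good x & forall y, good y -> le y x -> le x y.
  apply: contrapT => nomin.
  have step (x : {x | good x}) : exists y : {x | good x},
      le (sval y) (sval x) /\ ~ le (sval x) (sval y).
    case: x => x gx; apply: contrapT => noy; apply: nomin; exists x => // y gy yx.
    by apply: contrapT => nxy; apply: noy; exists (exist _ y gy).
  have g0 : good (existT _ a (idm a)).
    by split=> // W AW u v; rewrite /= !comp1m.
  have [F [_ FS]] := dependent_choice (fun x => cid (step x)) (exist _ _ g0).
  have gF n : A (tag (sval (F n))) /\ strict_mono_in A (tagged (sval (F n))).
    by have [? ? _] := svalP (F n); split=> //; exact: heart_mono_strict.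
  have [N HN] := flA.1 a Aa _ _ gF (fun n => (FS n).1).
  by have [_] := FS N; apply; exact: HN.
case: x => y i in gx minx *; case: gx => /= Ay im y0.
have [Q [q [h [AQ T]]]] := heart_mono_dist hD Ay Aa im.
exists y, Q; split=> //; last by exists i, q, h.
split=> // W f AW fm; have [W0|W0] := pselect (is_zero W); [by left|right].
have gW : good (existT _ W (i \o f)) by split=> //; exact: mono_in_comp.
have [|u /= Eu] := minx _ gW; first by exists f.
have fu : f \o u = idm y by apply: (im _ Ay); rewrite compA -Eu compm1.
exists u; split=> //.
by apply: (fm _ AW); rewrite compA fu comp1m compm1.
Qed.

Section Weight.
Variable w : C -> nat.
Hypothesis w_iso : forall X Y, isomorphic X Y -> w X = w Y.

(* [jh a n]: some composition series of [a] has total weight [n]. *)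
Inductive jh : C -> nat -> Prop :=
| jh0 a : is_zero a -> jh a 0
| jhS a' a y n : tri a' a y -> simple_in A y -> jh a' n -> jh a (n + w y).

Lemma jh_heart a n : jh a n -> A a.
Proof.
elim=> [b|b' b y m T [Ay _ _] _ Ab']; first exact: heart_zero.
exact: heart_ext T Ab' Ay.
Qed.

Lemma jh_iso a b n : isomorphic a b -> jh a n -> jh b n.
Proof.
move=> i j; case: j i => [{}a a0|a' {}a y m T sy j] i.
  by apply: jh0; exact: is_zero_iso i a0.
by apply: jhS j => //; apply: tri_iso T.
Qed.

Lemma jh_ext X Y Z n m : tri X Y Z -> jh X n -> jh Z m -> jh Y (n + m).
Proof.
move=> T jX jZ; elim: jZ Y T => [{}Z Z0|Z' {}Z y k TZ sy _ IH] Y T.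
  by rewrite addn0; apply: jh_iso jX; exact: tri_zero3_iso T.
have [F [T1 T2]] := tri_octa_fibre T TZ.
by rewrite addnA; apply: jhS T1 sy _; exact: IH.
Qed.

(** The exchange step of the Jordan-Hölder theorem: any simple quotient [z] can be split off first.
    If [a' -> a -> z] is zero then [z] is the last factor [y]; otherwise induction applies to the
    kernel [c] of [a' -> z], the intersection of [a'] and [b]. *)
Lemma jh_remove a n : jh a n -> forall b z, A b -> simple_in A z -> tri b a z ->
  exists2 k, n = (k + w z)%N & jh b k.
Proof.
elim=> {a n} [a a0|a' a y n [i [p [h T]]] sy ja' IH] b z Ab sz [i' [r [h' T']]].
  have [Az z0 _] := sz; case: z0.
  apply: (dist_epi_zero (D := D) T'); [exact: heart_aisle|exact: heart_coaisle|].
  exact: hom_from_zero.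
have [Ay y0 _] := sy; have [Az z0 _] := sz; have Aa' := jh_heart ja'.
have [ri|ri] := pselect (r \o i = 0).
  have [phi Ephi] := dist_factor T ri.
  have phii : is_iso phi.
    apply: (simple_hom_iso hD sy sz) => phi0; apply: z0.
    apply: (dist_epi_zero (D := D) T'); [exact: heart_aisle|exact: heart_coaisle|].
    by rewrite Ephi phi0 comp0m.
  exists n; first by congr (_ + _)%N; apply: w_iso; exists phi.
  apply: jh_iso ja'.
  have [phi' [p1 p2]] := phii.
  have T2 : dist i r (h \o phi').
    apply: (dist_iso (is_iso_id _) (is_iso_id _) phii _ _ _ T).
    - by rewrite comp1m compm1.
    - by rewrite compm1.
    - by rewrite shiftm1 comp1m -compA p1 compm1.
  exact: dist_fibre_unique T2 T'.
have [c [j [k [Ac T2]]]] := simple_epi_dist hD Aa' sz ri.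
have [m En jc] := IH c z Ac sz (ex_intro _ j (ex_intro _ _ (ex_intro _ _ T2))).
(* The octahedron on [a' -> a -> z] identifies [b/c] with [a/a' = y]. *)
have [u [v [T3 _ _ _ _]]] :=
  dist_octa T ((dist_rot _ _ _).1 T') ((dist_rot _ _ _).1 T2).
exists (m + w y)%N; first by rewrite En addnAC.
apply: jhS sy jc; apply/tri_unrot/tri_unrot; do 3!eexists; exact: T3.
Qed.

Lemma jh_inj a n m : jh a n -> jh a m -> n = m.
Proof.
move=> jn jm; elim: jm n jn => [b b0|a' b y {}m T sy ja' IH] n jn.
  case: jn b0 => [//|c' c z k [f [g [h T]]] [Az z0 _] jc c0]; case: z0.
  apply: (dist_epi_zero (D := D) T); [exact: heart_aisle (jh_heart jc)|exact: heart_coaisle|].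
  exact: hom_from_zero.
have [k -> jk] := jh_remove jn (jh_heart ja') sy T.
by rewrite (IH k).
Qed.

(** By the ascending chain condition there is a maximal subobject [S] with a composition series; a
    simple subobject of [a/S] would enlarge it. *)
Lemma jh_exists a : A a -> exists n, jh a n.
Proof.
move=> Aa.
pose sub := {S : C & Hom S a}.
pose good (x : sub) := [/\ A (tag x), mono_in A (tagged x) & exists n, jh (tag x) n].
pose le (x y : sub) := sub_le (tagged x) (tagged y).
have [x gx maxx] : exists2 x, good x & forall y, good y -> le x y -> le y x.
  apply: contrapT => nomax.
  have step (x : {x | good x}) : exists y : {x | good x},
      le (sval x) (sval y) /\ ~ le (sval y) (sval x).
    case: x => x gx; apply: contrapT => noy; apply: nomax; exists x => // y gy yx.
    by apply: contrapT => nxy; apply: noy; exists (exist _ y gy).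
  have [N N0] := has_zero C.
  have g0 : good (existT _ N (0 : Hom N a)).
    split=> /=; [exact: heart_zero| |by exists 0%N; exact: jh0].
    by move=> W AW u v _; rewrite (hom_to_zero u N0) (hom_to_zero v N0).
  have [F [_ FS]] := dependent_choice (fun x => cid (step x)) (exist _ _ g0).
  have gF n : A (tag (sval (F n))) /\ strict_mono_in A (tagged (sval (F n))).
    by have [? ? _] := svalP (F n); split=> //; exact: heart_mono_strict.
  have [M HM] := flA.2 a Aa _ _ gF (fun n => (FS n).1).
  by have [_] := FS M; apply; exact: HM.
case: x => S i in gx maxx *; case: gx => /= AS im [n jS].
have [Q [q [h [AQ T]]]] := heart_mono_dist hD AS Aa im.
have [Q0|Q0] := pselect (is_zero Q).
  by exists n; apply: jh_iso jS; exists i; exact: dist_zero_iso T Q0.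
have [y [R [sy AR [f [g [k T']]]]]] := heart_simple_sub AQ Q0.
have [Ay y0 _] := sy.
(* [S'] is the preimage of [y] in [a], the kernel of [a -> Q -> R]. *)
have [S' [j [l Tj]]] := dist_fibre (g \o q).
have gqi : (g \o q) \o i = 0 by rewrite -compA (dist_comp0 T) compm0.
have [i' Ei'] := dist_lift Tj gqi.
have [E [e1 [e2 Te]]] := dist_complete i'.
rewrite Ei' in T.
have [a' [b' [TE _ _ Eb _]]] := dist_octa Te Tj T.
have {}Eb : b' = g.
  apply/eqP; rewrite -subr_eq0; apply/eqP.
  apply: (dist_epi (D := D) T); [exact: heart_aisle|exact: heart_coaisle|].
  by rewrite compBl Eb subrr.
rewrite {}Eb in TE.
have iE := dist_fibre_unique TE T'.
have TS' : tri S S' y.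
  by apply: tri_iso iE _ => //; exists i', e1, e2.
have AS' := heart_ext hD TS' AS Ay.
have jm : mono_in A j by exact: heart_dist_mono Tj AR.
have [||v /= Ev] := maxx (existT _ S' j).
- by split=> //; exists (n + w y)%N; exact: jhS jS.
- by exists i'.
(* Maximality makes [S -> S'] invertible, so its cone [E], a copy of [y], would be zero. *)
case: y0; apply: is_zero_iso iE _; apply: dist_iso_zero Te _.
exists v; split; last first.
  by apply: (jm _ AS'); rewrite compA -Ei' -Ev compm1.
by apply: (im _ AS); rewrite compA -Ev -Ei' compm1.
Qed.

(** The default [0] is reached only by objects with no composition series, which by [jh_exists] lie
    outside the heart. *)
Definition weight a : nat := xget 0%N [set n | jh a n].

Lemma weight_jh a n : jh a n -> weight a = n.
Proof. by move=> j; apply: (jh_inj _ j); exact: (@xgetI _ 0%N [set n | jh a n] n). Qed.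

Lemma jh_weight a : A a -> jh a (weight a).
Proof. by move=> /jh_exists[n j]; rewrite (weight_jh j). Qed.

Lemma weight_tri X Y Z : tri X Y Z -> A X -> A Z ->
  weight Y = (weight X + weight Z)%N.
Proof.
move=> T AX AZ; apply: weight_jh.
by apply: jh_ext T _ _; exact: jh_weight.
Qed.

Lemma weight_simple y : simple_in A y -> weight y = w y.
Proof.
move=> sy; apply: weight_jh; have [N N0] := has_zero C.
by rewrite -[w y]add0n; apply: jhS (jh0 N0) => //; exact: tri_zero1.
Qed.

Lemma jh_quotient a n : jh a n -> ~ is_zero a ->
  exists a' y, [/\ tri a' a y, A a' & simple_in A y].
Proof.
case=> [{}a a0 /(_ a0)//|a' {}a y m T sy j _].
by exists a', y; split=> //; exact: jh_heart j.
Qed.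

End Weight.
End FiniteLength.

(** * Euler characteristics *)

Section Bounded.
Variables (C : triangulated) (D : set C).
Hypothesis hD : t_structure D.
Implicit Types X Y Z W c : C.

Lemma tri_iter n X Y Z :
  tri X Y Z <-> tri (iter n shift X) (iter n shift Y) (iter n shift Z).
Proof. by elim: n => //= n IH; rewrite IH; exact: tri_shift. Qed.

Lemma iter_shift_iso n X Y :
  isomorphic X Y <-> isomorphic (iter n shift X) (iter n shift Y).
Proof. by elim: n => //= n IH; rewrite IH; exact: shift_iso. Qed.

Lemma iter_shift_ess n Y : exists X, isomorphic Y (iter n shift X).
Proof.
elim: n => [|n [X iX]]; first by exists Y.
have [X' iX'] := shift_ess X; exists X'; rewrite iterSr.
by apply: isomorphic_trans iX _; exact: (iter_shift_iso n _ _).1 iX'.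
Qed.

Lemma is_zero_iter_shift n X : is_zero (iter n shift X) <-> is_zero X.
Proof. by elim: n => //= n IH; rewrite is_zero_shift. Qed.

Lemma aisle_iter n X : D X -> D (iter n shift X).
Proof. by move=> DX; elim: n => //= n IH; exact: aisle_shift. Qed.

Lemma iter_shift_down n c (P : set C) : iter n (@shift_down C) P c <-> P (iter n shift c).
Proof. by elim: n c => [//|n IH] c; rewrite iterS iterSr; exact: IH. Qed.

Lemma iter_shift_up n c (P : set C) : iter n (@shift_up C) P c ->
  exists2 X, P X & isomorphic c (iter n shift X).
Proof.
elim: n c => [|n IH] c; first by exists c.
move=> [Y /IH[X PX iX] iY]; exists X => //.
by apply: isomorphic_trans iY _; exact: (shift_iso _ _).1 iX.
Qed.

Lemma hom0_iso X X' Y Y' : isomorphic X X' -> isomorphic Y Y' ->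
  (forall f : Hom X Y, f = 0) -> forall f : Hom X' Y', f = 0.
Proof.
move=> [u [u' [u1 u2]]] [v [v' [v1 v2]]] h f.
have -> : f = v \o ((v' \o (f \o u)) \o u').
  by rewrite -!compA u2 compm1 compA v2 comp1m.
by rewrite (h (v' \o (f \o u))) comp0m compm0.
Qed.

Lemma hom0_iter n X Y : (forall f : Hom X Y, f = 0) <->
  (forall f : Hom (iter n shift X) (iter n shift Y), f = 0).
Proof.
elim: n => //= n ->; split=> h f; last by apply: shiftm_inj; rewrite shiftm0; exact: h.
by have [g ->] := shiftm_surj f; rewrite (h g) shiftm0.
Qed.

(** That is, [c] lies in [D^perp[n]]. This bounds the number of truncations and serves as the
    induction parameter; at [n = 0] an object of [D] is zero. *)
Definition below n c := forall W, D W -> forall f : Hom (iter n shift W) c, f = 0.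

Lemma bounded_aisle c : bounded D -> exists n, D (iter n shift c) /\ below n c.
Proof.
move=> /(_ c)[n [/iter_shift_down Dc /iter_shift_up[X oX iX]]]; exists n; split=> // W DW f.
apply: hom0_iso f; [exact: isomorphic_refl|exact: isomorphic_sym iX|].
exact: (hom0_iter n W X).1 (oX W DW).
Qed.

Lemma below0 c : D c -> below 0 c -> is_zero c.
Proof. by move=> Dc; apply. Qed.

Lemma below_trunc n V c H : tri (shift V) c H -> coaisle D H -> below n.+1 c -> below n V.
Proof.
move=> [f [g [h T]]] coH bc W DW u; apply: shiftm_inj; rewrite shiftm0.
apply: (dist_mono (D := D) T) => //; first exact: (aisle_iter n.+1 DW).
exact: bc.
Qed.

Lemma truncation_unique V V' c H H' : tri (shift V) c H -> tri (shift V') c H' ->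
  D V -> D V' -> coaisle D H -> coaisle D H' -> isomorphic V V' /\ isomorphic H H'.
Proof.
move=> [f [g [h T]]] [f' [g' [h' T']]] DV DV' coH coH'.
have [u Eu] := dist_lift T' (shift_heart_hom0 (g' \o f) DV coH').
have [u' Eu'] := dist_lift T (shift_heart_hom0 (g \o f') DV' coH).
have ui : is_iso u.
  exists u'; split; apply/eqP; rewrite -subr_eq0; apply/eqP.
    apply: (dist_mono (D := D) T) => //; first exact: aisle_shift.
    by rewrite compBr compA -Eu' -Eu compm1 subrr.
  apply: (dist_mono (D := D) T') => //; first exact: aisle_shift.
  by rewrite compBr compA -Eu -Eu' compm1 subrr.
split; first by apply/shift_iso; exists u.
have E : f' \o u = idm c \o f by rewrite comp1m -Eu.
by have [w [wi _ _]] := dist_morph_iso T T' E ui (is_iso_id _); exists w.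
Qed.

End Bounded.

(** * Extending an additive function from the heart to the aisle *)

Section Devissage.
Variables (C : triangulated) (D : set C).
Hypothesis hD : t_structure D.
Hypothesis bD : bounded D.
Local Notation A := (heart D).
Implicit Types X Y Z W c : C.

Variables (M : zmodType) (lam : C -> M).
Hypothesis lam_tri : forall X Y Z, tri X Y Z -> A X -> A Z -> lam Y = lam X + lam Z.

Lemma lam_zero X : is_zero X -> lam X = 0.
Proof.
move=> X0; have AX := heart_zero hD X0.
by apply: (@addrI _ (lam X)); rewrite addr0 -(@lam_tri X X X) //; exact: tri_zero1.
Qed.

Lemma lam_iso X Y : isomorphic X Y -> A X -> lam X = lam Y.
Proof.
move=> i AX; have [N N0] := has_zero C.
rewrite (@lam_tri N Y X) ?(lam_zero N0) ?add0r //; last exact: heart_zero.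
by apply: tri_zero1 => //; exact: isomorphic_sym.
Qed.

(* [val c z]: truncating [c] repeatedly yields [z], the alternating sum of the
   values of [lam] on the cohomology objects of [c]. *)
Inductive val : C -> M -> Prop :=
| val0 c : is_zero c -> val c 0
| valS V c H z : tri (shift V) c H -> A H -> val V z -> val c (lam H - z).

Lemma val_aisle c z : val c z -> D c.
Proof.
elim=> [b b0|V b H y T /heart_aisle DH _ DV]; first exact: aisle_zero.
by apply: aisle_ext T _ DH => //; exact: aisle_shift.
Qed.

Lemma val_iso c c' z : isomorphic c c' -> val c z -> val c' z.
Proof.
move=> i v; case: v i => [b b0|V b H y T AH vV] i; first by apply: val0; exact: is_zero_iso b0.
by apply: valS vV => //; apply: tri_iso T.
Qed.

Lemma val_zero c z : val c z -> is_zero c -> z = 0.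
Proof.
elim=> [//|V b H y T AH vV IH] b0.
have Tb : tri (shift b) b b by apply: tri_zero1 => //; exact/is_zero_shift.
have [iV iH] := truncation_unique hD T Tb (val_aisle vV) (aisle_zero hD b0)
  (heart_coaisle AH) (orthr_zero b0).
have V0 := is_zero_iso (isomorphic_sym iV) b0.
by rewrite (IH V0) (lam_zero (is_zero_iso (isomorphic_sym iH) b0)) subr0.
Qed.

Lemma val_inj c z z' : val c z -> val c z' -> z = z'.
Proof.
move=> v; elim: v z' => {c z} [c c0|V c H z T AH vV IH] z' v'; first by rewrite (val_zero v').
case: v' T => {c z'} [c c0|V' c H' z' T' AH' vV'] T.
  by rewrite (@val_zero c (lam H - z)) //; exact: valS T AH vV.
have [iV iH] := truncation_unique hD T T' (val_aisle vV) (val_aisle vV')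
  (heart_coaisle AH) (heart_coaisle AH').
by rewrite (lam_iso iH AH) (IH z') //; exact: val_iso (isomorphic_sym iV) vV'.
Qed.

Lemma val_exists c : D c -> exists z, val c z.
Proof.
move=> Dc; have [n [_ bc]] := bounded_aisle c bD.
elim: n c Dc bc => [|n IH] c Dc bc; first by exists 0; apply: val0; exact: below0 bc.
have [V [H [T DV coH]]] := truncation_shift hD c.
have [z vz] := IH V DV (below_trunc hD T coH bc).
exists (lam H - z); apply: valS vz => //; apply/heartP => //; split=> //.
by apply: (aisle_cone hD T) => //; exact: aisle_shift.
Qed.

Definition aval c : M := xget 0 [set z | val c z].

Lemma aval_val c : D c -> val c (aval c).
Proof. by move=> /val_exists; exact: (@xgetPex _ 0 [set z | val c z]). Qed.

Lemma aval_trunc V c H : tri (shift V) c H -> D V -> A H -> aval c = lam H - aval V.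
Proof.
move=> T DV AH; have v : val c (lam H - aval V) by apply: valS T AH _; exact: aval_val.
by apply: (val_inj (aval_val _) v); exact: val_aisle v.
Qed.

Lemma aval_zero c : is_zero c -> aval c = 0.
Proof. by move=> c0; exact: (val_zero (aval_val (aisle_zero hD c0)) c0). Qed.

Lemma aval_iso c c' : isomorphic c c' -> D c -> aval c = aval c'.
Proof.
move=> i Dc; have v := val_iso i (aval_val Dc).
by apply: (val_inj v (aval_val _)); exact: val_aisle v.
Qed.

Lemma aval_heart c : A c -> aval c = lam c.
Proof.
move=> Ac; have [N N0] := has_zero C.
rewrite (@aval_trunc N c c) ?(aval_zero N0) ?subr0 //; last exact: aisle_zero.
by apply: tri_zero1 => //; exact/is_zero_shift.
Qed.

Lemma aval_shift c : D c -> aval (shift c) = - aval c.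
Proof.
move=> Dc; have [N N0] := has_zero C.
rewrite (@aval_trunc c (shift c) N) ?(lam_zero N0) ?sub0r //; last exact: heart_zero.
exact: tri_zero3.
Qed.

Lemma heart_truncation c : D c ->
  exists V H, [/\ tri (shift V) c H, D V & A H].
Proof.
move=> Dc; have [V [H [T DV coH]]] := truncation_shift hD c.
exists V, H; split=> //; apply/heartP => //; split=> //.
by apply: (aisle_cone hD T) => //; exact: aisle_shift.
Qed.

(** By the octahedral axiom, [X] and [Y] have the same truncation part [W[1]], and their top
    cohomologies differ by [E]. *)
Lemma aval_add_heart_r X Y E : tri X Y E -> D X -> A E -> aval Y = aval X + lam E.
Proof.
move=> T DX AE; have [W [H [TX DW AH]]] := heart_truncation DX.
have [G [TY TG]] := tri_octa TX T.
rewrite (aval_trunc TY DW (heart_ext hD TG AH AE)) (aval_trunc TX DW AH).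
by rewrite (lam_tri TG AH AE) addrAC.
Qed.

(** This is the exact sequence [0 -> V -> F' -> X -> H -> Q -> 0], where [V] and [F'] are the
    shifted lower truncations of [Y] and [Z], cut at the image [I] of [X -> H]. *)
Lemma aval_add_heart_l X Y Z : tri X Y Z -> A X -> D Y -> aval Y = lam X + aval Z.
Proof.
move=> T AX DY.
have [V [H [[i [p [r TY]]] DV AH]]] := heart_truncation DY.
have [f [k [d Tf]]] := T.
have [N [I [Q [n [e [h [m [q [h' [[AN AI AQ] Tn Tm Ef]]]]]]]]]] :=
  heart_image hD (p \o f) AX AH.
(* The cone [K] of [X -> H] is an extension of [Q] by [N[1]] and also the cone of [V[1] -> Z];
   comparing the two yields the truncation of [Z]. *)
have [K [k1 [k2 TK]]] := dist_complete (p \o f).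
have TVK : tri (shift V) Z K.
  have [a [b [Tab _ _ _ _]]] := dist_octa Tf ((dist_rot _ _ _).1 TY) TK.
  by apply: tri_unrot; do 3!eexists; exact: Tab.
have TNK : tri (shift N) K Q.
  rewrite Ef in TK.
  have [a [b [Tab _ _ _ _]]] := dist_octa ((dist_rot _ _ _).1 Tn) Tm TK.
  by do 3!eexists; exact: Tab.
have [F [TF1 TF2]] := tri_octa_fibre TVK TNK.
have [F' iF] := shift_ess F.
have TF1' : tri (shift F') Z Q by apply: tri_iso TF1.
have TF2' : tri V F' N by apply/tri_shift; apply: tri_iso TF2.
have DF : D F' by apply: (aisle_ext hD TF2') => //; exact: heart_aisle.
have TYV : tri (shift V) Y H by exists i, p, r.
rewrite (aval_trunc TF1' DF AQ) (aval_add_heart_r TF2' DV AN) (aval_trunc TYV DV AH).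
rewrite (@lam_tri I H Q) //; last by do 3!eexists; exact: Tm.
rewrite (@lam_tri N X I) //; last by do 3!eexists; exact: Tn.
rewrite [lam N + _]addrC opprD (addrC (- aval V)) -!addrA; congr (_ + _).
by rewrite (addrCA (lam N)) addNKr.
Qed.

(** Induction on the [n] with [below n X]. The top cohomology [HX] is split off by
    [aval_add_heart_l]. What remains is a triangle [X1[1] -> Y -> W]; it reduces to [X1 -> V -> G'],
    where [X1] satisfies [below n]. *)
Lemma aval_add X Y Z : tri X Y Z -> D X -> D Y -> aval Y = aval X + aval Z.
Proof.
have [n [_ bX]] := bounded_aisle X bD.
elim: n X Y Z bX => [|n IH] X Y Z bX T DX DY.
  have X0 := below0 DX bX.
  by rewrite (aval_zero X0) add0r; apply: aval_iso DY; exact: tri_zero1_iso T.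
have [X1 [HX [TX DX1 AHX]]] := heart_truncation DX.
have [W [TW1 TW2]] := tri_octa TX T.
have DW : D W by apply: (aisle_cone hD TW1) => //; exact: aisle_shift.
rewrite (aval_trunc TX DX1 AHX) addrAC -(aval_add_heart_l TW2 AHX DW).
(* the map X1[1] -> Y factors through the truncation of Y *)
have [f [g [h T1]]] := TW1.
have [V [H [[i [p [r TY]]] DV AH]]] := heart_truncation DY.
have [u Eu] := dist_lift TY (shift_heart_hom0 (p \o f) DX1 (heart_coaisle AH)).
have [G [u1 [u2 Tu]]] := dist_complete u.
rewrite Eu in T1.
have [a [b [Tab _ _ _ _]]] := dist_octa Tu TY T1.
have [G' iG] := shift_ess G.
have TG : tri (shift G') W H by apply: tri_iso iG _ _ _ => //; do 3!eexists; exact: Tab.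
have TV : tri X1 V G'.
  by apply/tri_shift; apply: tri_iso iG _ => //; do 3!eexists; exact: Tu.
have DG : D G' by exact: aisle_cone TV DX1 DV.
have TYV : tri (shift V) Y H by exists i, p, r.
rewrite (aval_trunc TG DG AH) (aval_trunc TYV DV AH).
rewrite (IH X1 V G') //; last exact: below_trunc TX (heart_coaisle AHX) bX.
by rewrite opprD addrA addrAC.
Qed.

End Devissage.

(** * Extending it from the aisle to the whole category *)

Section EulerChar.
Variables (C : triangulated) (D : set C).
Hypothesis hD : t_structure D.
Hypothesis bD : bounded D.
Local Notation A := (heart D).
Variables (M : zmodType) (lam : C -> M).
Hypothesis lam_tri : forall X Y Z, tri X Y Z -> A X -> A Z -> lam Y = lam X + lam Z.

Let height c := xget 0%N [set n | D (iter n shift c)].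

Definition euler c : M :=
  iter (height c) -%R (aval D lam (iter (height c) shift c)).

(** A further shift inside [D] changes the sign of [aval], so any exponent that moves [c] into [D]
    gives the same value. A triangle can then be treated with one common exponent. *)
Lemma eulerE n c : D (iter n shift c) ->
  euler c = iter n -%R (aval D lam (iter n shift c)).
Proof.
have E k m : D (iter m shift c) -> iter (k + m) -%R (aval D lam (iter (k + m) shift c)) =
    iter m -%R (aval D lam (iter m shift c)).
  move=> Dm; elim: k => // k <-.
  have Dk : D (iter (k + m) shift c) by rewrite iterD; exact: aisle_iter.
  by rewrite addSn iterSr /= (aval_shift hD bD lam_tri Dk) opprK.
move=> Dn.
have Dh : D (iter (height c) shift c) by exact: (@xgetI _ _ [set n | D (iter n shift c)] n).
by rewrite /euler -(E n _ Dh) addnC (E _ _ Dn).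
Qed.

Lemma euler_heart c : A c -> euler c = lam c.
Proof.
move=> Ac; rewrite (@eulerE 0) /=; last exact: heart_aisle Ac.
exact: (aval_heart hD bD lam_tri Ac).
Qed.

Lemma iter_oppD n (x y : M) : iter n -%R (x + y) = iter n -%R x + iter n -%R y.
Proof. by elim: n => //= n ->; rewrite opprD. Qed.

Lemma euler_tri X Y Z : tri X Y Z -> euler Y = euler X + euler Z.
Proof.
have [n [DX _]] := bounded_aisle X bD; have [m [DY _]] := bounded_aisle Y bD => T.
have {}DX : D (iter (n + m) shift X) by rewrite addnC iterD; exact: aisle_iter.
have {}DY : D (iter (n + m) shift Y) by rewrite iterD; exact: aisle_iter.
have T' := (tri_iter (n + m) X Y Z).1 T.
have DZ := aisle_cone hD T' DX DY.
by rewrite (eulerE DX) (eulerE DY) (eulerE DZ) (aval_add hD bD lam_tri T') // iter_oppD.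
Qed.

End EulerChar.

(** * Universal property of the Grothendieck group *)

Section GrothendieckLift.
Variables (C : triangulated) (M : zmodType) (chi : C -> M).
Hypothesis chi_tri : forall X Y Z, tri X Y Z -> chi Y = chi X + chi Z.

Let lift (x : free_ob C) : M :=
  @freeg.fglift int (ssrint.zmodule M) {classic C} chi x.

Let lift_additive (x y : free_ob C) : lift (x - y) = lift x - lift y.
Proof. exact: (@freeg.lift_is_additive int {classic C} (ssrint.zmodule M) chi x y). Qed.

Let lift_gen X : lift (gen_ob X) = chi X.
Proof. by rewrite /lift /gen_ob freeg.liftU scale1r. Qed.

Let lift_rel x : k0_rel x -> lift x = 0.
Proof.
elim=> [|{}x y _ Ex _ Ey|X Y Z f g h T].
- by have := lift_additive 0 0; rewrite !subrr.
- by rewrite lift_additive Ex Ey subrr.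
rewrite !lift_additive !lift_gen (@chi_tri X Y Z); last by exists f, g, h.
by rewrite addrAC addrK subrr.
Qed.

Let quot : K0 C -> M := fun x => lift (repr x).

Let quot_pi x : quot (\pi_(Quotient.quot (@k0_pred C)) x)%qT = lift x.
Proof.
apply/eqP; rewrite -subr_eq0 -lift_additive; apply/eqP/lift_rel.
have : repr (\pi_(Quotient.quot (@k0_pred C)) x)%qT - x \in @k0_pred C.
  by rewrite Quotient.idealrBE reprK.
by move/asboolP.
Qed.

Let quot_additive : zmod_morphism quot.
Proof.
move=> x y; rewrite -[x]reprK -[y]reprK -raddfB.
by rewrite [LHS]quot_pi lift_additive -!quot_pi !reprK.
Qed.

HB.instance Definition _ := GRing.isZmodMorphism.Build (K0 C) M quot quot_additive.

Lemma k0_universal : exists Z : {additive K0 C -> M}, forall X, Z (k0_class X) = chi X.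
Proof.
by exists quot => X; rewrite /= /k0_class quot_pi lift_gen.
Qed.

End GrothendieckLift.

(** * Phases *)

Section Trigonometry.
Variable R : realType.
Implicit Types phi psi : R.

Lemma sinpi_gt0 phi : 0 < phi -> phi < 1 -> 0 < sin (pi * phi).
Proof.
move=> h0 h1; apply: sin_gt0_pi; rewrite mulr_gt0 ?pi_gt0 //=.
by rewrite gtr_pMr ?pi_gt0.
Qed.

Lemma sinpi_ge0 phi : 0 <= phi -> phi <= 1 -> 0 <= sin (pi * phi).
Proof.
move=> h0 h1; apply: sin_ge0_pi; rewrite mulr_ge0 ?pi_ge0 //=.
by rewrite ger_pMr ?pi_gt0.
Qed.

(** The angle [pi * phi] is the argument of [- x + i y]; the expression is the imaginary part of
    this number rotated by [- pi * phi]. *)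
Lemma polar_phase (x y : R) : 0 <= x -> 0 <= y -> 0 < x + y ->
  exists2 phi, 0 < phi <= 1 & x * sin (pi * phi) + y * cos (pi * phi) = 0.
Proof.
move=> x0 y0 xy.
pose r := Num.sqrt (x ^+ 2 + y ^+ 2).
have r2 : r ^+ 2 = x ^+ 2 + y ^+ 2 by rewrite sqr_sqrtr // addr_ge0 ?sqr_ge0.
have r0 : 0 < r.
  rewrite sqrtr_gt0; case: (ltrgtP 0 x) x0 => // [hx _|hx _].
    by rewrite ltr_pwDl ?sqr_ge0 ?exprn_gt0.
  by move: xy; rewrite -hx add0r expr0n add0r => hy; rewrite exprn_gt0.
pose c := - (x / r).
have c2 : c ^+ 2 = 1 - (y / r) ^+ 2.
  rewrite /c sqrrN !expr_div_n r2; field.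
  by rewrite -r2 expf_neq0 // gt_eqF.
have cle : -1 <= c <= 1.
  by rewrite -ler_norml -[leRHS]normr1 -ler_sqr ?nnegrE // !real_normK ?num_real //
    c2 expr1n gerBl sqr_ge0.
have c1 : c < 1 by rewrite (@le_lt_trans _ _ 0) // /c oppr_le0 divr_ge0 // ltW.
have yr0 : 0 <= y / r by rewrite divr_ge0 // ltW.
have cle' := cle; case/andP: cle' => cl cr.
exists (acos c / pi).
  rewrite divr_gt0 ?pi_gt0 ?acos_gt0 ?cl ?c1 //=.
  by rewrite ler_pdivrMr ?pi_gt0 // mul1r acos_lepi.
have -> : pi * (acos c / pi) = acos c by rewrite mulrC divfK // gt_eqF ?pi_gt0.
rewrite acosK ?in_itv //= sin_acos // c2 subKr sqrtr_sqr ger0_norm //.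
by rewrite /c mulrN mulrA [y * _]mulrA [x * y]mulrC subrr.
Qed.

Lemma polar_cos_sin (x y : R) phi : 0 <= x -> 0 <= y -> 0 < x + y -> 0 < phi <= 1 ->
  x * sin (pi * phi) + y * cos (pi * phi) = 0 ->
  exists m, [/\ 0 < m, x = - (m * cos (pi * phi)) & y = m * sin (pi * phi)].
Proof.
move=> x0 y0 xy /andP[f0 f1] E.
have cs := cos2Dsin2 (pi * phi).
have sge := sinpi_ge0 (ltW f0) f1.
move: sge cs E; case: (ltrgtP phi 1) f1 => // [hf|->] _; last first.
  rewrite mulr1 sinpi cospi => _ E; exists x; split; lra.
move: (sinpi_gt0 f0 hf); set S := sin _; set K := cos _ => S0 _ cs E.
have m0 : 0 <= y / S by rewrite divr_ge0 // ltW.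
have Ey : y = y / S * S by rewrite divfK // gt_eqF.
have Ex : x = - (y / S * K).
  apply: (@mulIf _ S); first by rewrite gt_eqF.
  by rewrite mulNr mulrAC -Ey; apply/eqP; rewrite -addr_eq0 E.
exists (y / S); split=> //; rewrite lt_def m0 andbT; apply/eqP => m00.
by move: xy; rewrite Ex Ey m00 !mul0r oppr0 addr0 ltxx.
Qed.

Lemma phase_lt (x y : R) phi psi : 0 <= x -> 0 <= y -> 0 < x + y ->
  0 < phi <= 1 -> 0 < psi <= 1 ->
  x * sin (pi * psi) + y * cos (pi * psi) = 0 ->
  0 < x * sin (pi * phi) + y * cos (pi * phi) -> phi < psi.
Proof.
move=> x0 y0 xy /andP[f0 f1] hpsi E; have [m [m0 -> ->]] := polar_cos_sin x0 y0 xy hpsi E.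
have -> : - (m * cos (pi * psi)) * sin (pi * phi) + m * sin (pi * psi) * cos (pi * phi)
  = m * sin (pi * psi - pi * phi) by rewrite sinB; ring.
rewrite pmulr_rgt0 // -mulrBr => h; rewrite ltNge; apply/negP => le.
case/andP: hpsi => p0 p1.
have : 0 <= sin (pi * (phi - psi)) by apply: sinpi_ge0; lra.
by rewrite -opprB mulrN sinN oppr_ge0 leNgt h.
Qed.

Lemma phase_unique (x y : R) phi psi : 0 <= x -> 0 <= y -> 0 < x + y ->
  0 < phi <= 1 -> 0 < psi <= 1 ->
  x * sin (pi * psi) + y * cos (pi * psi) = 0 ->
  x * sin (pi * phi) + y * cos (pi * phi) = 0 -> phi = psi.
Proof.
wlog lt : phi psi / psi < phi.
  move=> W x0 y0 xy hf hp E1 E2; case: (ltrgtP psi phi) => // h; first exact: W E1 E2.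
  by apply/esym; exact: (W _ _ h).
move=> x0 y0 xy hf hpsi E; have [m [m0 -> ->]] := polar_cos_sin x0 y0 xy hpsi E.
have -> : - (m * cos (pi * psi)) * sin (pi * phi) + m * sin (pi * psi) * cos (pi * phi)
  = - (m * sin (pi * phi - pi * psi)) by rewrite sinB; ring.
move/eqP; rewrite oppr_eq0 mulf_eq0 gt_eqF //= -mulrBr gt_eqF // sinpi_gt0; lra.
Qed.

(** A nonzero vector cannot have argument both at least [pi * phi] and at most [pi * psi]:
    eliminating [x] from the two inequalities leaves [y * sin (pi * (phi - psi)) <= 0]. *)
Lemma phase_hom0 (x y : R) phi psi : 0 <= x -> 0 <= y ->
  0 < psi -> psi < phi -> phi <= 1 ->
  0 <= x * sin (pi * phi) + y * cos (pi * phi) ->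
  x * sin (pi * psi) + y * cos (pi * psi) <= 0 -> x = 0 /\ y = 0.
Proof.
move=> x0 y0 p0 pf f1 E1 E2.
have s1 : 0 <= sin (pi * phi) by apply: sinpi_ge0; lra.
have s2 : 0 < sin (pi * psi) by apply: sinpi_gt0; lra.
have s3 : 0 < sin (pi * (phi - psi)) by apply: sinpi_gt0; lra.
move: s3; rewrite mulrBr sinB => s3.
have y00 : y = 0.
  apply/eqP; rewrite eq_le y0 andbT -(pmulr_rle0 _ s3).
  have {}E2 : 0 <= - (x * sin (pi * psi) + y * cos (pi * psi)) by rewrite oppr_ge0.
  by have := mulr_ge0 s1 E2; have := mulr_ge0 (ltW s2) E1; lra.
split=> //; apply/eqP; rewrite eq_le x0 andbT -(pmulr_lle0 _ s2).
by move: E2; rewrite y00 mul0r addr0.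
Qed.

End Trigonometry.

(** * Semistable objects of the heart *)

Section Semistable.
Variables (R : realType) (C : triangulated) (D : set C).
Hypothesis hD : t_structure D.
Local Notation A := (heart D).
Implicit Types (X Y Z W : C) (phi psi : R).

Variables p q : C -> nat.
Hypothesis p_tri : forall X Y Z, tri X Y Z -> A X -> A Z -> p Y = (p X + p Z)%N.
Hypothesis q_tri : forall X Y Z, tri X Y Z -> A X -> A Z -> q Y = (q X + q Z)%N.
Hypothesis pq_gt0 : forall X, A X -> ~ is_zero X -> (0 < p X + q X)%N.

(* For the charge [Z = - p + i q], this is [Im (Z * exp (- i pi phi))]. *)
Definition theta phi X : R :=
  (p X)%:R * sin (pi * phi) + (q X)%:R * cos (pi * phi).

Definition quotient_of X Z := exists K, [/\ A K, A Z & tri K X Z].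

(** For a nonzero quotient, [0 <= theta phi Z] says that its phase is at least [phi]. Zero objects
    are semistable of every phase in (0, 1]. *)
Definition semistable phi : set C := [set X |
  [/\ 0 < phi <= 1, A X, theta phi X = 0
    & forall Z, quotient_of X Z -> 0 <= theta phi Z]].

Lemma theta_tri phi X Y Z : tri X Y Z -> A X -> A Z ->
  theta phi Y = theta phi X + theta phi Z.
Proof. by move=> T AX AZ; rewrite /theta (p_tri T) // (q_tri T) // !natrD; ring. Qed.

Lemma pq_zero X : is_zero X -> p X = 0%N /\ q X = 0%N.
Proof.
move=> X0; have AX := heart_zero hD X0; have T := tri_zero1 X0 (@isomorphic_refl _ X).
by have := p_tri T AX AX; have := q_tri T AX AX; lia.
Qed.

Lemma theta_zero phi X : is_zero X -> theta phi X = 0.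
Proof. by move=> /pq_zero[]; rewrite /theta => -> ->; rewrite !mul0r addr0. Qed.

Lemma theta_iso phi X Y : isomorphic X Y -> A X -> theta phi X = theta phi Y.
Proof.
move=> i AX; have [N N0] := has_zero C.
have T : tri N Y X by apply: tri_zero1 => //; exact: isomorphic_sym.
by rewrite (theta_tri phi T) // ?(theta_zero _ N0) ?add0r //; exact: heart_zero.
Qed.

Lemma pq_pos X : A X -> ~ is_zero X -> 0 < (p X)%:R + (q X)%:R :> R.
Proof. by move=> AX X0; rewrite -natrD ltr0n; exact: pq_gt0. Qed.

Lemma quotient_self X : A X -> quotient_of X X.
Proof.
move=> AX; have [N N0] := has_zero C; exists N; split=> //; first exact: heart_zero.
exact: tri_zero1.
Qed.

Lemma quotient_trans Y X Z : quotient_of X Y -> quotient_of Y Z -> quotient_of X Z.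
Proof.
move=> [K [AK AY T]] [L [AL AZ T']]; have [F [T1 T2]] := tri_octa_fibre T T'.
by exists F; split=> //; exact: heart_ext T2 AK AL.
Qed.

Lemma quotient_iso X X' Z : isomorphic X X' -> quotient_of X Z -> quotient_of X' Z.
Proof. by move=> i [K [AK AZ T]]; exists K; split=> //; apply: tri_iso T. Qed.

Lemma semistable_iso phi : iso_closed (semistable phi).
Proof.
move=> X Y i [f AX tX qX]; split=> //; first exact: heart_iso i AX.
  by rewrite -(theta_iso phi i).
by move=> Z /(quotient_iso (isomorphic_sym i)); exact: qX.
Qed.

Lemma semistable_zero phi X : 0 < phi <= 1 -> is_zero X -> semistable phi X.
Proof.
move=> hphi X0; split=> //; [exact: heart_zero|exact: theta_zero|].
move=> Z [K [AK AZ T]]; rewrite theta_zero //.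
have [f [g [h T']]] := T.
apply: (dist_epi_zero (D := D) T'); [exact: heart_aisle|exact: heart_coaisle|].
exact: hom_from_zero.
Qed.

Lemma semistable_sub phi K X Z : semistable phi X -> A K -> A Z -> tri K X Z ->
  theta phi K <= 0.
Proof.
move=> [_ AX tX qX] AK AZ T.
have := qX Z (ex_intro _ K (And3 AK AZ T)).
by move: tX; rewrite (theta_tri phi T) //; lra.
Qed.

(** A quotient [B] of [Y] is an extension of a quotient [Q] of [Z] by the image [I] of [X] in
    [B]. *)
Lemma semistable_ext phi X Y Z : tri X Y Z -> semistable phi X -> semistable phi Z ->
  semistable phi Y.
Proof.
move=> T [hphi AX tX qX] [_ AZ tZ qZ]; split=> //; first exact: heart_ext T AX AZ.
  by rewrite (theta_tri phi T) // tX tZ addr0.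
move=> B [K [AK AB [k [g [d T']]]]].
have AY := heart_ext hD T AX AZ.
have [f [r [l TX]]] := T.
have [N [I [Q [n [e [h [m [c [h' [[AN AI AQ] Tn Tm Ef]]]]]]]]]] :=
  heart_image hD (g \o f) AX AB.
have [|u Eu] := dist_factor TX (u := c \o g).
  by rewrite -compA Ef compA (dist_comp0 Tm) comp0m.
have ue W (v : Hom Q W) : A W -> v \o u = 0 -> v = 0.
  move=> AW vu.
  apply: (dist_epi (D := D) Tm); [exact: heart_aisle|exact: heart_coaisle|].
  apply: (dist_epi (D := D) T'); [exact: heart_aisle|exact: heart_coaisle|].
  by rewrite -compA Eu compA vu comp0m.
have [L [v [w [AL TL]]]] := heart_epi_dist hD AZ AQ (fun W AW v => @ue W v AW).
have tI : 0 <= theta phi I by apply: qX; exists N; split=> //; exists n, e, h.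
have tQ : 0 <= theta phi Q by apply: qZ; exists L; split=> //; exists v, u, w.
have TB : tri I B Q by exists m, c, h'.
by rewrite (theta_tri phi TB AI AQ) addr_ge0.
Qed.

(** The image of [f] is a quotient of [X] and a subobject of [Y], so its phase would be at least
    [phi] and at most [psi]. *)
Lemma semistable_hom0 phi psi X Y : psi < phi -> semistable phi X -> semistable psi Y ->
  forall f : Hom X Y, f = 0.
Proof.
move=> lt sX sY f; have [/andP[_ f1] AX _ qX] := sX; have [/andP[p0 _] AY _ _] := sY.
have [N [I [Q [n [e [h [m [c [h' [[AN AI AQ] Tn Tm ->]]]]]]]]]] := heart_image hD f AX AY.
have tI : 0 <= theta phi I by apply: qX; exists N; split=> //; exists n, e, h.
have tI' : theta psi I <= 0.
  by apply: semistable_sub sY AI AQ _; exists m, c, h'.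
have [/eqP pI /eqP qI] := phase_hom0 (ler0n _ _) (ler0n _ _) p0 lt f1 tI tI'.
have I0 : is_zero I.
  apply: contrapT => /(pq_gt0 AI).
  by move: pI qI; rewrite !pnatr_eq0 => /eqP -> /eqP ->.
by rewrite (hom_to_zero e I0) compm0.
Qed.

Lemma semistable_polar phi X : semistable phi X -> ~ is_zero X -> exists m : R,
  [/\ 0 < m, (p X)%:R = - (m * cos (pi * phi)) & (q X)%:R = m * sin (pi * phi)].
Proof.
move=> [hphi AX tX _] X0.
exact: polar_cos_sin (ler0n _ _) (ler0n _ _) (pq_pos AX X0) hphi tX.
Qed.

Lemma hn_heart X s : hn semistable X s -> A X.
Proof.
elim=> [c|c' c a s' phi f g h _ Ac' T [_ Aa _ _] _ _]; first exact: heart_zero.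
by apply: (heart_ext hD (X := c') (Z := a)) => //; exists f, g, h.
Qed.

(* The last Harder-Narasimhan factor is a quotient of minimal phase which is
   maximal for its length among these. *)
Lemma minimal_quotient X : A X -> ~ is_zero X -> exists phi K Z,
  [/\ semistable phi Z, ~ is_zero Z, A K & tri K X Z] /\
  (forall W, quotient_of K W -> ~ is_zero W -> 0 < theta phi W).
Proof.
move=> AX X0.
(* The quotients of [X] form no finite set, but their pairs ([p], [q]) do. The phase of [- p + i q]
   increases with [p / (p + q)], so minimising [key] minimises the phase. *)
pose T := ('I_(p X).+1 * 'I_(q X).+1)%type.
pose P (x : T) := `[< exists Z, [/\ quotient_of X Z, ~ is_zero Z, p Z = x.1 & q Z = x.2] >].
pose key (x : T) : R := (x.1 : nat)%:R / ((x.1 : nat)%:R + (x.2 : nat)%:R).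
have pqX Z : quotient_of X Z -> ((p Z < (p X).+1)%N * (q Z < (q X).+1)%N)%type.
  by move=> [K [AK AZ TK]]; rewrite (p_tri TK) // (q_tri TK) //; split; lia.
pose ofq Z (hZ : quotient_of X Z) : T := (Ordinal (pqX Z hZ).1, Ordinal (pqX Z hZ).2).
have P0 : P (ofq X (quotient_self AX)).
  by apply/asboolP; exists X; split=> //; exact: quotient_self.
case: (arg_minP key P0) => x /asboolP[Z0 [qZ0 nZ0 pZ0 qZ0']] minx.
have AZ0 : A Z0 by case: qZ0 => ? [].
have [phi hphi tZ0] :=
  @polar_phase R (p Z0)%:R (q Z0)%:R (ler0n _ _) (ler0n _ _) (pq_pos AZ0 nZ0).
have tge Z : quotient_of X Z -> 0 <= theta phi Z.
  move=> qZ; have [Zz|nZ] := pselect (is_zero Z); first by rewrite theta_zero.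
  have AZ : A Z by case: qZ => ? [].
  have /minx : P (ofq Z qZ) by apply/asboolP; exists Z.
  rewrite /key /= -pZ0 -qZ0' ler_pdivrMr ?pq_pos // mulrAC ler_pdivlMr ?pq_pos //.
  have [m [m0 Ep Eq]] := polar_cos_sin (ler0n _ _) (ler0n _ _) (pq_pos AZ0 nZ0) hphi tZ0.
  rewrite /theta Ep Eq => h; rewrite -(pmulr_rge0 _ m0); lra.
pose len Z := (p Z + q Z)%N.
pose G n := `[< exists Z, [/\ quotient_of X Z, theta phi Z = 0 & len Z = n] >].
have exG : exists n, G n by exists (len Z0); apply/asboolP; exists Z0.
have ubG n : G n -> (n <= len X)%N.
  by move=> /asboolP[Z [/pqX[]]]; rewrite /len => + + _ <-; lia.
case: (ex_maxnP exG ubG) => n /asboolP[Z [qZ tZ lZ]] maxn.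
have [K [AK AZ TK]] := qZ.
have nZ : ~ is_zero Z.
  move=> /pq_zero[pz qz]; have /maxn : G (len Z0) by apply/asboolP; exists Z0.
  by move: (pq_gt0 AZ0 nZ0); rewrite -lZ /len pz qz; lia.
exists phi, K, Z; split.
  split=> //; split=> // W qW; apply: tge; exact: quotient_trans qZ qW.
move=> W [L [AL AW TL]] nW.
(* [V] is the quotient of [X] that extends [Z] by [W]. If [theta phi W] were zero, [V] would have
   the same phase as [Z] and a greater length. *)
have [V [TV1 TV2]] := tri_octa TL TK.
have AV := heart_ext hD TV2 AW AZ.
have qV : quotient_of X V by exists L.
have := tge V qV; rewrite (theta_tri phi TV2) // tZ addr0 le_eqVlt => /orP[/eqP tW|//].
have /maxn : G (len V).
  by apply/asboolP; exists V; split=> //; rewrite (theta_tri phi TV2) // tZ addr0.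
by move: (pq_gt0 AW nW); rewrite -lZ /len (p_tri TV2) // (q_tri TV2) //; lia.
Qed.

Lemma hn_exists X : A X -> exists s, hn semistable X s.
Proof.
move: {2}(p X + q X)%N (leqnn (p X + q X)) => n; elim: n X => [|n IH] X len AX.
  exists [::]; apply: hn0; apply: contrapT => /(pq_gt0 AX); lia.
have [X0|nX] := pselect (is_zero X); first by exists [::]; exact: hn0.
have [phi [K [Z [[sZ nZ AK T] pos]]]] := minimal_quotient AX nX.
have [hphi AZ _ _] := sZ.
have [|s hs] := IH K _ AK.
  by move: len (pq_gt0 AZ nZ); rewrite (p_tri T) // (q_tri T) //; lia.
have [f [g [h T']]] := T.
exists (rcons s (phi, Z)); apply: hnS T' sZ nZ _ => //.
(* The last factor [a] of [K] is a nonzero quotient of [K], so [pos] puts its phase strictly above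
   [phi]. *)
case: hs pos => //= c' c a s' psi f' g' h' hc' Tc sa na all_s pos.
have [hpsi Aa ta _] := sa.
have lt : phi < psi.
  apply: (phase_lt (ler0n _ (p a)) (ler0n _ (q a)) _ hphi hpsi ta); first exact: pq_pos.
  by apply: pos na; exists c'; split=> //; [exact: hn_heart hc'|exists f', g', h'].
rewrite all_rcons /= lt /=; apply: sub_all all_s => y /=; exact: lt_trans.
Qed.

End Semistable.

(** * The slicing *)

Section HarderNarasimhan.
Variables (R : realType) (C : triangulated) (P : R -> set C).
Implicit Types (X Y Z c : C) (s : seq (R * C)).

Lemma hn_iso X Y s : isomorphic X Y -> hn P X s -> hn P Y s.
Proof.
move=> i h; case: h i => [c c0|c' c a s' phi f g h hc' T Pa a0 al] i.
  by apply: hn0; exact: is_zero_iso c0.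
have [u ui] := i; have [u' [u'u uu']] := ui.
apply: (hnS (f := u \o f) (g := g \o u') (h := h) hc' _ Pa a0 al).
apply: (dist_iso (is_iso_id _) ui (is_iso_id _) _ _ _ T).
- by rewrite compm1.
- by rewrite comp1m -compA u'u compm1.
- by rewrite shiftm1 comp1m compm1.
Qed.

Lemma hn_tri c' c a s phi : hn P c' s -> tri c' c a -> P phi a -> ~ is_zero a ->
  all (fun x => phi < x.1) s -> hn P c (rcons s (phi, a)).
Proof. by move=> hc' [f [g [h T]]]; exact: hnS hc' T. Qed.

(** Each filtration step of [Y] is pulled back to [c], which keeps its cone. *)
Lemma hn_cat X c Y s t : hn P X s -> hn P Y t -> tri X c Y ->
  all (fun y => all (fun x => y.1 < x.1) s) t -> hn P c (s ++ t).
Proof.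
move=> hX hY; elim: hY c => [Z Z0|c' Z a t' phi f g h _ IH T Pa a0 al] c TX.
  by rewrite cats0 => _; apply: hn_iso hX; exact: tri_zero3_iso TX.
rewrite all_rcons /= => /andP[als alt].
have TZ : tri c' Z a by exists f, g, h.
have [F [T1 T2]] := tri_octa_fibre TX TZ.
rewrite -rcons_cat; apply: hn_tri (IH F T2 alt) T1 Pa a0 _.
by rewrite all_cat als al.
Qed.

Hypothesis P_shift : forall phi X, P (phi + 1) (shift X) <-> P phi X.
Hypothesis P_iso : forall phi, iso_closed (P phi).

Lemma hn_shift c s : hn P c s ->
  exists2 t, hn P (shift c) t & unzip1 t = [seq x + 1 | x <- unzip1 s].
Proof.
elim=> [{}c c0|c' {}c a {}s phi f g h _ [t ht Et] T Pa a0 al].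
  by exists [::] => //; apply: hn0; exact/is_zero_shift.
exists (rcons t (phi + 1, shift a)); last first.
  by rewrite /unzip1 !map_rcons -/(unzip1 _) Et.
apply: (hn_tri ht).
- by apply: (tri_shift _ _ _).1; exists f, g, h.
- exact: (P_shift _ _).2.
- by move=> /is_zero_shift.
rewrite -(all_map fst (fun x => phi + 1 < x)) -/(unzip1 t) Et all_map /unzip1 all_map.
by apply: sub_all al => x /=; rewrite ltrD2r.
Qed.

Lemma hn_unshift d s : hn P d s -> forall c, isomorphic d (shift c) ->
  exists2 t, hn P c t & unzip1 t = [seq x - 1 | x <- unzip1 s].
Proof.
elim=> [{}d d0|d' {}d a {}s phi f g h _ IH T Pa a0 al] c i.
  exists [::] => //; apply: hn0; apply/is_zero_shift; exact: is_zero_iso i d0.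
have [c' ic'] := shift_ess d'; have [b ib] := shift_ess a.
have [t ht Et] := IH c' ic'.
exists (rcons t (phi - 1, b)); last first.
  by rewrite /unzip1 !map_rcons -/(unzip1 _) Et.
apply: (hn_tri ht).
- by apply: (tri_shift _ _ _).2; apply: tri_iso ic' i ib _; exists f, g, h.
- by apply: (P_shift _ _).1; rewrite subrK; exact: P_iso ib Pa.
- by move=> /is_zero_shift b0; apply: a0; apply: is_zero_iso b0; exact: isomorphic_sym.
rewrite -(all_map fst (fun x => phi - 1 < x)) -/(unzip1 t) Et all_map /unzip1 all_map.
by apply: sub_all al => x /=; rewrite ltrD2r.
Qed.

End HarderNarasimhan.

Lemma hn_sub (R : realType) (C : triangulated) (P Q : R -> set C) :
  (forall phi, P phi `<=` Q phi) -> forall c s, hn P c s -> hn Q c s.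
Proof.
move=> PQ c s; elim=> [{}c c0|c' {}c a {}s phi f g h _ IH T Pa a0 al].
  exact: hn0.
by apply: hnS IH T _ a0 al; exact: PQ.
Qed.

Section Slicing.
Variables (R : realType) (C : triangulated) (D : set C).
Hypothesis hD : t_structure D.
Hypothesis bD : bounded D.
Local Notation A := (heart D).
Implicit Types (X Y Z W : C) (phi psi : R).

Variables p q : C -> nat.
Hypothesis p_tri : forall X Y Z, tri X Y Z -> A X -> A Z -> p Y = (p X + p Z)%N.
Hypothesis q_tri : forall X Y Z, tri X Y Z -> A X -> A Z -> q Y = (q X + q Z)%N.
Hypothesis pq_gt0 : forall X, A X -> ~ is_zero X -> (0 < p X + q X)%N.

Local Notation ss := (@semistable R C D p q).

(* The semistable objects of [A] of phase [phi + m - n] in (0, 1], shifted by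
   [n - m]. *)
Definition slicing phi : set C := [set X | exists (m n : nat) Y,
  ss (phi + m%:R - n%:R) Y /\ isomorphic (iter m shift X) (iter n shift Y)].

(** The integer [1 - ceil phi] moves [phi] into (0, 1]; it is split as [m - n] because only
    nonnegative shifts can be iterated. *)
Lemma phase_normalize phi : exists m n : nat, 0 < phi + m%:R - n%:R <= 1.
Proof.
have := real_ceil_itv (num_real phi); rewrite intrB.
case: (Num.ceil phi) => k; rewrite ?NegzE ?intrN -pmulrn => h.
  case: k h => [|k] h; first by exists 1%N, 0%N; lra.
  by exists 0%N, k; move: h; rewrite -(addn1 k) natrD; lra.
by exists k.+2, 0%N; move: h; rewrite -(addn1 k.+1) natrD; lra.
Qed.

Lemma phase_unique_nat phi m n m' n' :
  0 < phi + m%:R - n%:R <= 1 -> 0 < phi + m'%:R - n'%:R <= 1 ->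
  (m + n' = m' + n)%N.
Proof.
move=> h h'; have l a b : (a%:R < b%:R + 1 :> R) -> (a <= b)%N.
  by rewrite natr1 ltr_nat ltnS.
by apply/eqP; rewrite eqn_leq !l // !natrD; lra.
Qed.

Lemma slicingP m n phi X : 0 < phi + m%:R - n%:R <= 1 ->
  slicing phi X <-> exists2 Y, ss (phi + m%:R - n%:R) Y &
    isomorphic (iter m shift X) (iter n shift Y).
Proof.
move=> h; split=> [[m' [n' [Y [sY i]]]]|[Y sY i]]; last by exists m, n, Y.
have [h' _ _ _] := sY; have E := phase_unique_nat h h'.
exists Y.
  suff -> : phi + m%:R - n%:R = phi + m'%:R - n'%:R by [].
  by have := congr1 (fun x => x%:R : R) E; rewrite !natrD; lra.
apply: (iter_shift_iso m' _ _).2; rewrite -!iterD -E (addnC m') !iterD.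
exact: (iter_shift_iso m _ _).1.
Qed.

Lemma slicing_iso phi : iso_closed (slicing phi).
Proof.
move=> X X' i [m [n [Y [sY iY]]]]; exists m, n, Y; split=> //.
by apply: isomorphic_trans iY; apply: (iter_shift_iso m _ _).1; exact: isomorphic_sym.
Qed.

Lemma slicing_zero phi X : is_zero X -> slicing phi X.
Proof.
move=> X0; have [m [n h]] := phase_normalize phi; exists m, n, X; split.
  exact: semistable_zero.
by apply: is_zero_isomorphic; apply: (is_zero_iter_shift _ _).2.
Qed.

Lemma slicing_heart phi X : 0 < phi <= 1 -> slicing phi X <-> ss phi X.
Proof.
move=> h; have h0 : 0 < phi + 0%:R - 0%:R <= 1 by rewrite addr0 subr0.
rewrite (slicingP X h0) addr0 subr0 /=; split=> [[Y sY i]|sX]; last by exists X.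
exact: semistable_iso (isomorphic_sym i) sY.
Qed.

Lemma slicing_shift phi X : slicing (phi + 1) (shift X) <-> slicing phi X.
Proof.
split=> -[m [n [Y [sY i]]]].
  exists m.+1, n, Y; rewrite iterSr; split=> //.
  suff -> : phi + m.+1%:R - n%:R = phi + 1 + m%:R - n%:R by [].
  by rewrite -(addn1 m) natrD; lra.
exists m, n.+1, Y; split; last by rewrite -iterSr; exact: (shift_iso _ _).1.
suff -> : phi + 1 + m%:R - n.+1%:R = phi + m%:R - n%:R by [].
by rewrite -(addn1 n) natrD; lra.
Qed.

Lemma slicing_shift_up phi : slicing (phi + 1) = shift_up (slicing phi).
Proof.
apply/seteqP; split=> X.
  have [X' i] := shift_ess X => sX; exists X' => //.
  by apply: (slicing_shift _ _).1; exact: slicing_iso sX.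
move=> [X' /slicing_shift sX' i]; exact: slicing_iso (isomorphic_sym i) sX'.
Qed.

Lemma slicing_ext phi X Y Z : tri X Y Z -> slicing phi X -> slicing phi Z -> slicing phi Y.
Proof.
have [m [n h]] := phase_normalize phi => T.
move=> /(slicingP X h)[X' sX iX] /(slicingP Z h)[Z' sZ iZ]; apply/(slicingP Y h).
have [Y' iY] := iter_shift_ess n (iter m shift Y).
exists Y' => //; apply: semistable_ext sX sZ => //.
apply: (tri_iter n _ _ _).2; apply: tri_iso iX iY iZ _.
exact: (tri_iter m _ _ _).1.
Qed.

Lemma slicing_hom0 phi psi X Y : psi < phi -> slicing phi X -> slicing psi Y ->
  forall f : Hom X Y, f = 0.
Proof.
move=> lt [m [n [X' [sX iX]]]] [m' [n' [Y' [sY iY]]]].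
apply: (hom0_iter (m + m') _ _).2.
have iX' : isomorphic (iter (m + m') shift X) (iter (m' + n) shift X').
  by rewrite addnC !iterD; exact: (iter_shift_iso m' _ _).1.
have iY' : isomorphic (iter (m + m') shift Y) (iter (m + n') shift Y').
  by rewrite !iterD; exact: (iter_shift_iso m _ _).1.
apply: hom0_iso (isomorphic_sym iX') (isomorphic_sym iY') _.
have [/andP[hX0 hX1] AX _ _] := sX; have [/andP[hY0 hY1] AY _ _] := sY.
(* After the common shift the maps go from [X'[m' + n]] to [Y'[m + n']]. A smaller shift on the left
   contradicts [psi < phi], a larger one leaves no maps between objects of the heart, and equal
   shifts reduce to [semistable_hom0]. *)
have [lt'|gt|E] := ltngtP (m' + n) (m + n').
- have : ((m' + n).+1%:R <= (m + n')%:R :> R) by rewrite ler_nat.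
  rewrite -addn1 !natrD; lra.
- have -> : (m' + n = m + n' + (m' + n - (m + n').+1).+1)%N by lia.
  rewrite iterD iterS.
  apply: (hom0_iter _ _ _).1 => f.
  apply: (shift_heart_hom0 (D := D) f); last exact: heart_coaisle AY.
  by apply: aisle_iter => //; exact: heart_aisle.
rewrite E; apply: (hom0_iter _ _ _).1; apply: semistable_hom0 sX sY => //.
by have := congr1 (fun x => x%:R : R) E; rewrite !natrD; lra.
Qed.

Lemma slicing_hn_heart X : A X -> exists2 s, hn slicing X s &
  all (fun x => 0 < x <= 1) (unzip1 s).
Proof.
move=> AX; have [s hs] := hn_exists R hD p_tri q_tri pq_gt0 AX; exists s.
  by apply: hn_sub hs => phi Y sY; apply/slicing_heart => //; case: sY.
elim: hs => //= c' c a t phi f g h _ IH _ [hphi _ _ _] _ _.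
by rewrite /unzip1 map_rcons all_rcons /= hphi.
Qed.

(** In the truncation [V[1] -> X -> H], the phases of [V[1]] exceed 1 and those of [H] are at most
    1, so the two filtrations concatenate. *)
Lemma slicing_hn_aisle X : D X -> exists2 s, hn slicing X s & all (fun x => 0 < x) (unzip1 s).
Proof.
move=> DX; have [n [_ bX]] := bounded_aisle X bD.
elim: n X DX bX => [|n IH] X DX bX; first by exists [::] => //; apply: hn0; exact: below0 bX.
have [V [H [T DV AH]]] := heart_truncation hD DX.
have [s hs ps] := IH V DV (below_trunc hD T (heart_coaisle AH) bX).
have [s' hs' Es'] := hn_shift slicing_shift hs.
have [t ht pt] := slicing_hn_heart AH.
have ps' : all (fun x => 1 < x.1) s'.
  rewrite -(all_map fst (fun x => 1 < x)) -/(unzip1 s') Es' all_map.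
  by apply: sub_all ps => x /=; rewrite ltrDr.
exists (s' ++ t).
  apply: hn_cat hs' ht T _; move: pt; rewrite all_map; apply: sub_all => y /= /andP[_ y1].
  by apply: sub_all ps' => x /=; exact: le_lt_trans.
rewrite /unzip1 map_cat all_cat -!/(unzip1 _); apply/andP; split.
  by rewrite all_map; apply: sub_all ps' => x /=; exact: lt_trans.
by apply: sub_all pt => x /andP[].
Qed.

Lemma slicing_hn X : exists s, hn slicing X s.
Proof.
have [n [DX _]] := bounded_aisle X bD; have [s hs _] := slicing_hn_aisle DX.
elim: n X {DX} s hs => [|n IH] X s hs; first by exists s.
have [t ht _] := hn_unshift slicing_shift slicing_iso hs (@isomorphic_refl _ _).
exact: IH ht.
Qed.

Lemma slicing_generates_heart :
  ext_closure [set X | exists2 phi, [set` `]0, 1]] phi & slicing phi X] = A.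
Proof.
apply/seteqP; split=> X.
  elim=> {X} [X [phi /=]|X|X Y i _|X Y Z f g h T _ AX _ AZ].
  - by rewrite in_itv /= => hphi /(slicing_heart _ hphi)[].
  - exact: heart_zero.
  - exact: heart_iso.
  - by apply: (heart_ext hD (X := X) (Z := Z)) => //; exists f, g, h.
move=> /slicing_hn_heart[s hs]; elim: hs => [c c0 _|c' c a t phi f g h _ IH T Pa _ _].
  exact: ext_zero.
rewrite /unzip1 map_rcons all_rcons /= => /andP[hphi /IH ec].
by apply: ext_tri T ec _; apply: ext_gen; exists phi => //=; rewrite in_itv.
Qed.

Variable chi : C -> R[i].
Hypothesis chi_tri : forall X Y Z, tri X Y Z -> chi Y = chi X + chi Z.
Hypothesis chi_heart : forall X, A X -> chi X = (- (p X)%:R +i* (q X)%:R)%C.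

Lemma chi_iter n X : chi (iter n shift X) = (-1) ^+ n * chi X.
Proof.
elim: n => [|n IH]; first by rewrite mul1r.
rewrite exprS -mulrA -IH mulN1r iterS; have [N N0] := has_zero C.
have T : tri (iter n shift X) N (shift (iter n shift X)) by apply: tri_rot; exact: tri_zero3.
apply/eqP; rewrite -addr_eq0 addrC -(chi_tri T).
by have := chi_tri (tri_zero1 N0 (@isomorphic_refl _ N));
    rewrite -{1}[chi N]addr0 => /addrI <-.
Qed.

Lemma chi_iso X Y : isomorphic X Y -> chi X = chi Y.
Proof.
move=> i; have [N N0] := has_zero C.
have chiN : chi N = 0.
  by have := chi_tri (tri_zero1 N0 (@isomorphic_refl _ N));
    rewrite -{1}[chi N]addr0 => /addrI <-.
by rewrite (chi_tri (tri_zero1 N0 i)) chiN add0r.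
Qed.

Lemma expipiD1 phi : expipi (phi + 1) = - expipi phi.
Proof.
rewrite /expipi mulrDr mulr1 cosDpi sinDpi.
by apply/eqP; rewrite eq_complex /= !eqxx.
Qed.

Lemma expipiDn phi n : expipi (phi + n%:R) = (-1) ^+ n * expipi phi.
Proof.
elim: n => [|n IH]; first by rewrite addr0 mul1r.
by rewrite -natr1 addrA expipiD1 IH exprS mulN1r mulNr.
Qed.

Lemma slicing_charge phi X : slicing phi X -> ~ is_zero X ->
  exists2 m : R, 0 < m & chi X = (m%:C * expipi phi)%C.
Proof.
move=> [m [n [Y [sY i]]]] X0.
have Y0 : ~ is_zero Y.
  move=> Y0; apply: X0; apply: (is_zero_iter_shift m _).1.
  by apply: is_zero_iso (isomorphic_sym i) _; exact: (is_zero_iter_shift n _).2.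
have [_ AY _ _] := sY.
have [r [r0 Ep Eq]] := semistable_polar pq_gt0 sY Y0.
exists r => //.
have chiY : chi Y = (r%:C * expipi (phi + m%:R - n%:R))%C.
  rewrite (chi_heart AY) Ep Eq /expipi; apply/eqP.
  by rewrite eq_complex /= !mul0r subr0 addr0 opprK !eqxx.
have sgn k : (-1) ^+ k * (-1) ^+ k = 1 :> R[i].
  by rewrite -expr2 -exprM mulnC exprM sqrrN !expr1n.
have En : expipi (phi + m%:R - n%:R) = (-1) ^+ n * ((-1) ^+ m * expipi phi).
  by rewrite -expipiDn -[in RHS](subrK n%:R (phi + m%:R)) expipiDn mulrA sgn mul1r.
have := chi_iter m X; rewrite (chi_iso i) chi_iter chiY En => /(congr1 ( *%R ((-1) ^+ m))).
rewrite [RHS]mulrA sgn mul1r => <-.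
move: (sgn m) (sgn n); set u := (-1) ^+ m; set v := (-1) ^+ n => uu vv.
transitivity ((u * u) * (v * v) * (r%:C * expipi phi))%C; first by ring.
by rewrite uu vv !mul1r.
Qed.

End Slicing.

(** * Local finiteness *)

Section Transport.
Variables (C : triangulated) (F : C -> C) (Fm : forall X Y : C, Hom X Y -> Hom (F X) (F Y)).
Hypothesis FmM : forall X Y Z (g : Hom Y Z) (f : Hom X Y), Fm (g \o f) = Fm g \o Fm f.
Hypothesis Fm0 : forall X Y, Fm (0 : Hom X Y) = 0.
Hypothesis Fm_inj : forall X Y, injective (@Fm X Y).
Hypothesis Fm_surj : forall X Y (g : Hom (F X) (F Y)), exists f, g = Fm f.
Hypothesis F_ess : forall Y, exists X, isomorphic Y (F X).
Variable P : set C.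
Hypothesis P_iso : iso_closed P.

Let Q : set C := [set X | P (F X)].

Lemma transport_strict_mono X Y (f : Hom X Y) :
  strict_mono_in Q f -> strict_mono_in P (Fm f).
Proof.
move=> [Z [g [QZ [gf ker]]]]; exists (F Z), (Fm g); split=> //; split.
  by rewrite -FmM gf Fm0.
move=> W PW u gu; have [W' [a ai]] := F_ess W; have [a' [a'a aa']] := ai.
have [u' Eu] := Fm_surj (u \o a').
have QW : Q W' by apply: P_iso PW; exists a.
have [|v [Ev uniq]] := ker W' QW u'.
  by apply: Fm_inj; rewrite FmM -Eu compA gu comp0m Fm0.
exists (Fm v \o a); split.
  by rewrite compA -FmM -Ev -Eu -compA a'a compm1.
move=> w Ew; have [w' Ew'] := Fm_surj (w \o a').
rewrite (uniq w'); first by rewrite -Ew' -compA a'a compm1.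
by apply: Fm_inj; rewrite FmM -Ew' compA -Ew.
Qed.

Lemma transport_sub_le X X' Y (f : Hom X Y) (f' : Hom X' Y) :
  sub_le f f' <-> sub_le (Fm f) (Fm f').
Proof.
split=> [[u ->]|[u]]; first by exists (Fm u); rewrite FmM.
by have [v ->] := Fm_surj u; rewrite -FmM => /Fm_inj ->; exists v.
Qed.

Lemma transport_finite_length : finite_length P -> finite_length Q.
Proof.
move=> [aP nP]; split=> Y QY S i Si le.
  have [||N HN] := aP (F Y) QY (fun n => F (S n)) (fun n => Fm (i n)).
  - by move=> n; have [? /transport_strict_mono] := Si n.
  - by move=> n; exact: (transport_sub_le _ _).1.
  by exists N => n /HN le1; exact: (transport_sub_le _ _).2 le1.
have [||N HN] := nP (F Y) QY (fun n => F (S n)) (fun n => Fm (i n)).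
- by move=> n; have [? /transport_strict_mono] := Si n.
- by move=> n; exact: (transport_sub_le _ _).1.
by exists N => n /HN le1; exact: (transport_sub_le _ _).2 le1.
Qed.

End Transport.

Section ShiftFiniteLength.
Variable C : triangulated.
Implicit Types (X Y Z : C) (P : set C).

Lemma shift_down_iso_closed P : iso_closed P -> iso_closed (shift_down P).
Proof. by move=> Piso X Y i; apply: Piso; exact: (shift_iso _ _).1. Qed.

Lemma shift_up_iso_closed P : iso_closed (shift_up P).
Proof.
move=> X Y i [Z PZ iZ]; exists Z => //; apply: isomorphic_trans iZ.
exact: isomorphic_sym.
Qed.

Lemma finite_length_shift_down P : iso_closed P -> finite_length P ->
  finite_length (shift_down P).
Proof.
move=> Piso; apply: (@transport_finite_length C shift (fun X Y => @shiftm C X Y)) => //.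
- by move=> *; rewrite shiftmM.
- exact: shiftm0.
- by move=> X Y; exact: shiftm_inj.
- by move=> X Y; exact: shiftm_surj.
- exact: shift_ess.
Qed.

(** [shift_up P] is the preimage of [P] under a quasi-inverse of the shift; choice provides this as
    [U] on objects and [Um] on morphisms. *)
Lemma finite_length_shift_up P : iso_closed P -> finite_length P ->
  finite_length (shift_up P).
Proof.
move=> Piso flP.
have [U HU] : exists U : C -> C, forall X, isomorphic X (shift (U X)).
  by exists (fun X => sval (cid (shift_ess X))) => X; exact: svalP (cid (shift_ess X)).
have [e He] : exists e : forall X, Hom X (shift (U X)), forall X, is_iso (e X).
  by exists (fun X => sval (cid (HU X))) => X; exact: svalP (cid (HU X)).
have [e' He'] : exists e' : forall X, Hom (shift (U X)) X,
    forall X, e' X \o e X = idm X /\ e X \o e' X = idm _.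
  by exists (fun X => sval (cid (He X))) => X; exact: svalP (cid (He X)).
have [Um HUm] : exists Um : forall X Y, Hom X Y -> Hom (U X) (U Y),
    forall X Y (f : Hom X Y), shiftm (Um X Y f) = e Y \o (f \o e' X).
  have H X Y (f : Hom X Y) := cid (shiftm_surj (e Y \o (f \o e' X))).
  by exists (fun X Y f => sval (H X Y f)) => X Y f; rewrite -(svalP (H X Y f)).
have -> : shift_up P = [set X | P (U X)].
  apply/seteqP; split=> X /=; last by exists (U X).
  move=> [Y PY iX]; apply: Piso PY; apply: (shift_iso _ _).2.
  by apply: isomorphic_trans (isomorphic_sym iX) _; exact: HU.
apply: (@transport_finite_length C U Um) => //.
- move=> X Y Z g f; apply: shiftm_inj; rewrite shiftmM !HUm.
  by rewrite -!compA; congr (_ \o (_ \o _)); rewrite compA (He' Y).1 comp1m.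
- by move=> X Y; apply: shiftm_inj; rewrite HUm comp0m compm0 shiftm0.
- move=> X Y f g /(congr1 shiftm); rewrite !HUm => /(congr1 (fun h => e' Y \o (h \o e X))).
  by rewrite -!compA (He' X).1 !compm1 !compA (He' Y).1 !comp1m.
- move=> X Y g; exists (e' Y \o (shiftm g \o e X)); apply: shiftm_inj; rewrite HUm.
  by rewrite -!compA (He' X).2 compm1 compA (He' Y).2 comp1m.
- move=> Y; exists (shift Y); apply: (shift_iso _ _).2; exact: HU.
Qed.

Lemma finite_length_iter_down n P : iso_closed P -> finite_length P ->
  finite_length (iter n (@shift_down C) P).
Proof.
move=> Piso flP.
suff [] : iso_closed (iter n (@shift_down C) P) /\
  finite_length (iter n (@shift_down C) P) by [].
elim: n => //= n [IH1 IH2]; split; first exact: shift_down_iso_closed.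
exact: finite_length_shift_down.
Qed.

Lemma iter_up_iso_closed n P : iso_closed P -> iso_closed (iter n (@shift_up C) P).
Proof. by case: n => // n _; exact: shift_up_iso_closed. Qed.

Lemma finite_length_iter_up n P : iso_closed P -> finite_length P ->
  finite_length (iter n (@shift_up C) P).
Proof.
move=> Piso flP; elim: n => //= n IH; apply: finite_length_shift_up => //.
exact: iter_up_iso_closed.
Qed.

Lemma iter_shift_upP n P X : iso_closed P -> iter n (@shift_up C) P X <->
  exists2 Y, P Y & isomorphic X (iter n shift Y).
Proof.
move=> Piso; split; first exact: iter_shift_up.
elim: n X => [|n IH] X [Y PY i]; first exact: Piso (isomorphic_sym i) PY.
by exists (iter n shift Y) => //; apply: IH; exists Y.
Qed.

End ShiftFiniteLength.

Lemma finite_gap (R : realType) (T : finType) (g : T -> R) :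
  exists2 e, 0 < e & forall x, g x != 0 -> e <= `|g x|.
Proof.
suff [e e0 He] : exists2 e, 0 < e & forall x, x \in enum T -> g x != 0 -> e <= `|g x|.
  by exists e => // x; apply: He; rewrite mem_enum.
elim: (enum T) => [|x s [e e0 He]]; first by exists 1.
have [gx|gx] := eqVneq (g x) 0.
  by exists e => // y; rewrite inE => /orP[/eqP -> /eqP //|]; exact: He.
exists (Num.min e `|g x|); first by rewrite lt_min e0 normr_gt0.
move=> y; rewrite inE ge_min => /orP[/eqP ->|ys gy]; first by rewrite lexx orbT.
by rewrite He.
Qed.

Section LocallyFinite.
Variables (R : realType) (C : triangulated) (D : set C).
Hypothesis hD : t_structure D.
Local Notation A := (heart D).
Hypothesis flA : finite_length A.
Hypothesis indA : finitely_many_indecomposables A.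
Implicit Types (X Y Z W : C) (phi psi : R).

Variables p q : C -> nat.
Hypothesis p_tri : forall X Y Z, tri X Y Z -> A X -> A Z -> p Y = (p X + p Z)%N.
Hypothesis q_tri : forall X Y Z, tri X Y Z -> A X -> A Z -> q Y = (q X + q Z)%N.
Hypothesis pq_gt0 : forall X, A X -> ~ is_zero X -> (0 < p X + q X)%N.

Local Notation ss := (@semistable R C D p q).
Local Notation slicing := (@slicing R C D p q).

(** The kernel [N] of [g] taken in [A] is itself semistable of phase [phi], so [f] and [n] factor
    through each other. The comparison map [w] then has a left inverse, and [f = n \o w] is a
    monomorphism in [A]. *)
Lemma semistable_kernel_mono phi X Y (f : Hom X Y) :
  ss phi X -> ss phi Y -> strict_mono_in (ss phi) f -> mono_in A f.
Proof.
move=> sX sY [Z [g [sZ [gf ker]]]].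
have [_ AX _ _] := sX; have [hphi AY tY qY] := sY; have [_ AZ _ _] := sZ.
have [N [I [Q [n [e [h [m [c [h' [[AN AI AQ] Tn Tm Eg]]]]]]]]]] := heart_image hD g AY AZ.
have TN : tri N Y I by exists n, e, h.
have TI : tri I Z Q by exists m, c, h'.
(* As a quotient of [Y] the image has nonnegative [theta], as a subobject of [Z] nonpositive. *)
have tI : theta p q phi I = 0.
  apply/eqP; rewrite eq_le (semistable_sub p_tri q_tri sZ AI AQ TI) /=.
  by apply: qY; exists N.
have tN : theta p q phi N = 0.
  by move: tY; rewrite (theta_tri p_tri q_tri phi TN) // tI addr0.
have sN : ss phi N.
  split=> // W [K [AK AW TK]].
  have [V [T1 T2]] := tri_octa TK TN.
  have := semistable_sub p_tri q_tri sY AK (heart_ext hD T2 AW AI) T1.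
  by move: tN; rewrite (theta_tri p_tri q_tri phi TK) //; lra.
have nm : mono_in A n by exact: heart_dist_mono Tn AI.
have gn : g \o n = 0 by rewrite Eg -compA (dist_comp0 Tn) compm0.
have [v [Ev _]] := ker N sN n gn.
have [w Ew] : exists w, f = n \o w.
  apply: (dist_lift Tn).
  have mm : mono_in A m by exact: heart_dist_mono Tm AQ.
  by apply: (mm X AX); rewrite compm0 compA -Eg.
have vw : v \o w = idm X.
  have [u [_ uniq]] := ker X sX f gf.
  by rewrite -(uniq (idm X)) ?compm1 // -(uniq (v \o w)) // compA -Ev.
move=> W AW a b E.
suff E' : w \o a = w \o b by rewrite -(comp1m a) -(comp1m b) -vw -!compA E'.
by apply: (nm W AW); rewrite !compA -Ew.
Qed.

Lemma semistable_finite_length phi : finite_length (ss phi).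
Proof.
have sm Y (S : nat -> C) (i : forall n, Hom (S n) Y) : ss phi Y ->
    (forall n, ss phi (S n) /\ strict_mono_in (ss phi) (i n)) ->
    forall n, A (S n) /\ strict_mono_in A (i n).
  move=> sY Si n; have [sS sm] := Si n.
  have [_ AS _ _] := sS; have [_ AY _ _] := sY.
  by split=> //; apply: heart_mono_strict => //; exact: semistable_kernel_mono sS sY sm.
split=> Y sY S i Si le; have [_ AY _ _] := sY.
  exact: flA.1 Y AY S i (sm Y S i sY Si) le.
exact: flA.2 Y AY S i (sm Y S i sY Si) le.
Qed.

Lemma slicing_finite_length phi : finite_length (slicing phi).
Proof.
have [m [n h]] := phase_normalize phi.
have -> : slicing phi = iter m (@shift_down C) (iter n (@shift_up C) (ss (phi + m%:R - n%:R))).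
  have siso := semistable_iso hD p_tri q_tri (phi := phi + m%:R - n%:R).
  apply/seteqP; split=> X.
    move=> /(slicingP D p q X h)[Y sY i].
    by apply/iter_shift_down/iter_shift_upP => //; exists Y.
  move=> /iter_shift_down/iter_shift_up[Y sY i].
  by apply/(slicingP D p q X h); exists Y.
apply: finite_length_iter_down; first exact/iter_up_iso_closed/semistable_iso.
apply: finite_length_iter_up; first exact: semistable_iso.
exact: semistable_finite_length.
Qed.

Lemma indecomposable_retract X : A X -> ~ is_zero X ->
  exists Y (i : Hom Y X) (r : Hom X Y), indecomposable_in A Y /\ r \o i = idm Y.
Proof.
move: {2}(p X + q X)%N (leqnn (p X + q X)) => n; elim: n X => [|n IH] X len AX X0.
  by have := pq_gt0 AX X0; lia.
have [iX|niX] := pselect (indecomposable_in A X).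
  by exists X, (idm X), (idm X); rewrite comp1m.
have [Y [Z [AY AZ [i [j [r [k [ri kj rj ki ij]]]]] Y0 Z0]]] :
    exists Y Z, [/\ A Y, A Z, is_biproduct Y Z X, ~ is_zero Y & ~ is_zero Z].
  apply: contrapT => H; apply: niX; split=> // Y Z AY AZ b.
  have [?|Y0] := pselect (is_zero Y); first by left.
  have [?|Z0] := pselect (is_zero Z); first by right.
  by case: H; exists Y, Z.
have T : tri Y X Z by apply: tri_biproduct; exists i, j, r, k.
have [|W [a [b [iW ba]]]] := IH Y _ AY Y0.
  by move: len (pq_gt0 AZ Z0); rewrite (p_tri T) // (q_tri T) //; lia.
exists W, (i \o a), (b \o r); split=> //.
by rewrite -compA (compA r) ri comp1m.
Qed.

(** A retract is both a quotient and a subobject, which gives the two opposite inequalities. *)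
Lemma semistable_retract phi X Y (i : Hom Y X) (r : Hom X Y) : ss phi X -> A Y ->
  r \o i = idm Y -> theta p q phi Y = 0.
Proof.
move=> sX AY ri; have [_ AX _ qX] := sX.
have [|N [n [h [AN Tn]]]] := heart_epi_dist hD (f := r) AX AY.
  by move=> W AW u ur; rewrite -(compm1 u) -ri compA ur comp0m.
have [|Q [c [h' [AQ Tc]]]] := heart_mono_dist hD (f := i) AY AX.
  by move=> W AW u v E; rewrite -(comp1m u) -(comp1m v) -ri -!compA E.
apply/eqP; rewrite eq_le; apply/andP; split; last first.
  by apply: qX; exists N; split=> //; exists n, r, h.
by apply: (semistable_sub p_tri q_tri sX AY AQ); exists i, c, h'.
Qed.

(** A nonzero semistable object has an indecomposable retract of the same phase, and [p] and [q]
    determine the phase of a nonzero object of the heart. *)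
Lemma finitely_many_phases : exists n (f : 'I_n -> R),
  forall phi X, ss phi X -> ~ is_zero X -> exists i, phi = f i.
Proof.
have [n [x Hx]] := indA.
have Hf i : exists phi, A (x i) -> ~ is_zero (x i) -> 0 < phi <= 1 /\ theta p q phi (x i) = 0.
  have [[Ax x0]|nx] := pselect (A (x i) /\ ~ is_zero (x i)); last first.
    by exists 0 => Ax x0; case: nx.
  have [phi h E] := @polar_phase R (p (x i))%:R (q (x i))%:R
    (ler0n _ _) (ler0n _ _) (pq_pos R pq_gt0 Ax x0).
  by exists phi.
have [f Ef] := choice Hf.
exists n, f => phi X sX X0; have [hphi AX _ _] := sX.
have [Y [a [r [iY ra]]]] := indecomposable_retract AX X0.
have [AY Y0 _] := iY.
have tY := semistable_retract sX AY ra.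
have [i iso] := Hx Y iY; exists i.
have Ax := heart_iso hD iso AY.
have x0 : ~ is_zero (x i) by move=> /(is_zero_iso (isomorphic_sym iso)).
have [hf tf] := Ef i Ax x0.
apply: (phase_unique (ler0n _ (p (x i))) (ler0n _ (q (x i))) _ hphi hf tf).
  exact: (pq_pos R pq_gt0 Ax x0).
by rewrite -[LHS](theta_iso hD p_tri q_tri phi iso).
Qed.

Lemma slicing_phase_gap : exists2 e : R, 0 < e & forall phi psi X Y,
  slicing phi X -> slicing psi Y -> ~ is_zero X -> ~ is_zero Y ->
  `|phi - psi| < e -> phi = psi.
Proof.
have [n [f Hf]] := finitely_many_phases.
(* Phases in (0, 1] differ by less than 1. So if two phases of the slicing differ by less than 1,
   their integer shifts differ by -1, 0 or 1, encoded as an element of ['I_3] minus 1. *)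
pose g (x : 'I_n * 'I_n * 'I_3) : R := f x.1.1 - f x.1.2 + (x.2 : nat)%:R - 1.
have [e e0 He] := finite_gap g.
exists (Num.min e 1); first by rewrite lt_min e0 ltr01.
have nzero m m' (X X' : C) : isomorphic (iter m shift X) (iter m' shift X') ->
    ~ is_zero X -> ~ is_zero X'.
  move=> i X0 X'0; apply: X0; apply: (is_zero_iter_shift m _).1.
  by apply: is_zero_iso (isomorphic_sym i) _; exact: (is_zero_iter_shift _ _).2.
move=> phi psi X Y [a [b [X' [sX iX]]]] [c [d [Y' [sY iY]]]] X0 Y0.
rewrite lt_min => /andP[h1 h2].
have [i Ei] := Hf _ _ sX (nzero _ _ _ _ iX X0).
have [j Ej] := Hf _ _ sY (nzero _ _ _ _ iY Y0).
have [hi _ _ _] := sX; have [hj _ _ _] := sY.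
have l (u v : nat) : (u%:R < v%:R + 1 :> R) -> (u <= v)%N by rewrite natr1 ltr_nat ltnS.
move: h2; rewrite ltr_norml => h2.
have k1 : (b + c <= a + d + 1)%N by apply: l; rewrite !natrD; lra.
have k2 : (a + d <= b + c + 1)%N by apply: l; rewrite !natrD; lra.
have k3 : (b + c + 1 - (a + d) < 3)%N by lia.
have Ek := congr1 (fun u => u%:R : R) (subnK k2).
have := He (i, j, Ordinal k3); rewrite /g /= -Ei -Ej.
have -> : phi + a%:R - b%:R - (psi + c%:R - d%:R) + (b + c + 1 - (a + d))%:R - 1 = phi - psi.
  by move: Ek; rewrite !natrD; lra.
move=> H; apply/eqP; rewrite -subr_eq0; apply/negPn/negP => /H.
by rewrite leNgt h1.
Qed.

(** An interval of length [e], the phase gap, contains at most one phase with nonzero objects, so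
    the category it generates is a single slice. *)
Lemma slicing_locally_finite : exists2 e : R, 0 < e & forall t,
  finite_length
    (ext_closure [set X | exists2 phi, [set` `](t - e), (t + e)[] phi & slicing phi X]).
Proof.
have [e e0 He] := slicing_phase_gap; exists (e / 2); first by rewrite divr_gt0.
move=> t; set I := [set` _].
have [phi [Iphi Hphi]] : exists phi, I phi /\
    forall psi X, I psi -> slicing psi X -> ~ is_zero X -> psi = phi.
  have [[phi [X [Iphi sX X0]]]|H] :=
    pselect (exists phi X, [/\ I phi, slicing phi X & ~ is_zero X]).
    exists phi; split=> // psi Y Ipsi sY Y0; apply: (He _ _ _ _ sY sX) => //.
    by move: Iphi Ipsi; rewrite /I /= !in_itv /= ltr_norml => /andP[? ?] /andP[? ?]; lra.
  (* Here the interval carries only zero objects, and any of its phases will do. *)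
  exists t; split; first by rewrite /I /= in_itv /=; lra.
  by move=> psi X Ipsi sX X0; case: H; exists psi, X.
suff -> : ext_closure [set X | exists2 phi, I phi & slicing phi X] = slicing phi.
  exact: slicing_finite_length.
apply/seteqP; split=> X; last by move=> sX; apply: ext_gen; exists phi.
elim=> {X} [X [psi Ipsi sX]|X|X Y i _|X Y Z f g h T _ AX _ AZ].
- have [X0|X0] := pselect (is_zero X); first exact: slicing_zero.
  by rewrite -(Hphi psi X).
- exact: slicing_zero.
- exact: slicing_iso.
- by apply: (slicing_ext hD p_tri q_tri (X := X) (Z := Z)) => //; exists f, g, h.
Qed.

End LocallyFinite.

(** * Aisles and phases *)

Section StabilityAisle.
Variables (R : realType) (C : triangulated) (s : stability R C).
Implicit Types (X Y Z c : C) (L : seq (R * C)).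

Lemma slice_shiftP phi X : slice s (phi + 1) (shift X) <-> slice s phi X.
Proof.
rewrite slice_shift; split=> [[Y sY i]|sX]; last by exists X.
by apply: slice_iso sY; apply: isomorphic_sym; exact: (shift_iso _ _).2.
Qed.

Lemma slice_iter_shift n phi X : slice s (phi + n%:R) (iter n shift X) <-> slice s phi X.
Proof.
elim: n => [|n IH]; first by rewrite addr0.
by rewrite -natr1 addrA iterS slice_shiftP.
Qed.

Lemma hn_hom0 c L phi a : hn (slice s) c L -> all (fun x => phi < x) (unzip1 L) ->
  slice s phi a -> forall f : Hom c a, f = 0.
Proof.
move=> hc; elim: hc => [{}c c0|c' {}c b {}L psi f g h _ IH T sb b0 al].
  by move=> _ _ u; exact: hom_from_zero.
rewrite /unzip1 map_rcons all_rcons /= => /andP[lt /IH{}IH] sa u.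
have [v ->] := dist_factor T (IH sa (u \o f)).
by rewrite (slice_hom lt sb sa v) comp0m.
Qed.

Lemma hn_shift_hom0 c L phi a : hn (slice s) c L -> all (fun x => phi - 1 < x) (unzip1 L) ->
  slice s phi a -> forall f : Hom (shift c) a, f = 0.
Proof.
move=> hc al sa f; have [a' i] := shift_ess a.
have sa' : slice s (phi - 1) a'.
  by apply: (slice_shiftP _ _).1; rewrite subrK; exact: slice_iso i sa.
apply: hom0_iso f; [exact: isomorphic_refl|exact: isomorphic_sym i|] => f.
by have [g ->] := shiftm_surj f; rewrite (hn_hom0 hc al sa' g) shiftm0.
Qed.

(** If [g] were zero, the identity of [a] would factor through [c'[1]], whose phases all exceed
    [phi]. *)
Lemma hn_last_neq0 c c' a L phi (f : Hom c' c) (g : Hom c a) h :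
  hn (slice s) c' L -> dist f g h -> slice s phi a -> ~ is_zero a ->
  all (fun x => phi < x.1) L -> g <> 0.
Proof.
move=> hc' T sa a0 al g0; apply: a0.
have [|r Er] := dist_factor_h T (u := idm a); first by rewrite g0 compm0.
rewrite /is_zero Er (hn_shift_hom0 hc' _ sa r) ?comp0m //.
by rewrite all_map; apply: sub_all al => x /= lt; rewrite (lt_trans _ lt) // ltrBlDr ltrDl.
Qed.

Variable D : set C.
Hypothesis hD : t_structure D.
Hypothesis hs : stability_heart s = heart D.

Lemma slice_shift_of_heart phi X : slice s phi X ->
  exists m n Y, [/\ 0 < phi + m%:R - n%:R <= 1, heart D Y
    & isomorphic (iter m shift X) (iter n shift Y)].
Proof.
move=> sX; have [m [n h]] := phase_normalize phi.
have [Y i] := iter_shift_ess n (iter m shift X).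
exists m, n, Y; split=> //; rewrite -hs; apply: ext_gen.
exists (phi + m%:R - n%:R); first by rewrite /= in_itv.
apply: (slice_iter_shift n _ _).1; rewrite subrK; apply: slice_iso i _.
exact: (slice_iter_shift m _ _).2.
Qed.

Lemma slice_aisle phi X : 0 < phi -> slice s phi X -> D X.
Proof.
move=> phi0 /slice_shift_of_heart[m [n [Y [h AY i]]]].
have mn : (m <= n)%N.
  have : m%:R < n.+1%:R :> R by rewrite -natr1; lra.
  by rewrite ltr_nat ltnS.
have {}i : isomorphic X (iter (n - m) shift Y).
  by apply: (iter_shift_iso m _ _).2; rewrite -iterD subnKC.
case: (hD) => + _ _; apply; first exact: isomorphic_sym i.
by apply: aisle_iter => //; exact: heart_aisle.
Qed.

Lemma slice_orthr phi X : phi <= 0 -> slice s phi X -> orthr D X.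
Proof.
move=> phi0 /slice_shift_of_heart[m [n [Y [h AY i]]]].
have nm : (n < m)%N by rewrite -(ltr_nat R); lra.
move: i; rewrite -(subnKC nm) addSnnS iterD iterS => /(iter_shift_iso n _ _).2 i W DW.
apply: (hom0_iter (m - n.+1).+1 _ _).2.
apply: hom0_iso (isomorphic_refl) (isomorphic_sym i) _ => f.
apply: (shift_heart_hom0 (D := D) f); last exact: heart_coaisle AY.
exact: aisle_iter.
Qed.

(** Were the last phase at most 0, the last factor would lie in [D^perp], yet it receives a nonzero
    map from [c]. *)
Lemma hn_aisle c L : hn (slice s) c L -> D c <-> all (fun x => 0 < x) (unzip1 L).
Proof.
move=> hc; split; last first.
  elim: hc => [{}c c0 _|c' {}c a {}L phi f g h _ IH T sa _ _]; first exact: aisle_zero.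
  rewrite /unzip1 map_rcons all_rcons /= => /andP[phi0 /IH Dc'].
  apply: (aisle_ext hD (X := c') (Z := a)) => //; first by exists f, g, h.
  exact: slice_aisle sa.
case: hc => [//|c' {}c a {}L phi f g h hc' T sa a0 al] Dc.
have phi0 : 0 < phi.
  rewrite ltNge; apply/negP => le.
  exact: (hn_last_neq0 hc' T sa a0 al) (slice_orthr le sa Dc g).
rewrite /unzip1 map_rcons all_rcons /= phi0 all_map.
by apply: sub_all al => x /=; exact: lt_trans.
Qed.

Lemma hn_coaisle_hom0 c L t : hn (slice s) c L -> all (fun x => 1 < x) (unzip1 L) ->
  coaisle D t -> forall f : Hom c t, f = 0.
Proof.
move=> hc al cot; have [c0 i] := shift_ess c.
have [L0 hL0 EL0] := hn_unshift slice_shiftP (@slice_iso _ _ s) hc i.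
apply: hom0_iso (isomorphic_sym i) isomorphic_refl _ => f.
apply: (shift_heart_hom0 (D := D) f) => //; apply/(hn_aisle hL0).
by rewrite EL0 all_map; apply: sub_all al => x /=; rewrite subr_gt0.
Qed.

(** The last hypothesis says that the phases of [d] are at least 0, so those of [t] are at least 1.
    Phases above 1 are excluded because [t] is in the coaisle. *)
Lemma heart_phase1 t d L : heart D t -> isomorphic t (shift d) -> hn (slice s) d L ->
  (forall x, x < 0 -> all (fun y => x < y) (unzip1 L)) -> slice s 1 t.
Proof.
move=> /heart_coaisle cot i hL pos.
have [K hK] := slice_hn s t; case: hK i cot => [c c0 _ _|]; first exact: slice_zero.
move=> c' c a K' phi f g h hK T sa a0 al i cot.
have hc := hnS hK T sa a0 al.
have phi1 : 1 <= phi.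
  rewrite leNgt; apply/negP => lt; apply: (hn_last_neq0 hK T sa a0 al).
  apply: (hom0_iso (isomorphic_sym i) isomorphic_refl _ g).
  by apply: hn_shift_hom0 hL _ sa; apply: pos; lra.
have alK : all (fun x => phi < x) (unzip1 K') by rewrite all_map.
(* All phases of [c'] exceed 1, so it has no maps to [t], and [t] reduces to its last factor. *)
have c'0 : is_zero c'.
  have f0 : f = 0.
    apply: hn_coaisle_hom0 hK _ cot _; apply: sub_all alK => x; exact: le_lt_trans.
  have [|v Ev] := dist_lift_s T (u := idm c'); first by rewrite f0 comp0m.
  apply: (is_zero_shift _).1; rewrite /is_zero -shiftm1 Ev.
  rewrite (hn_shift_hom0 hK _ sa v) ?compm0 //.
  by apply: sub_all alK => x /=; lra.
have ic : isomorphic c a by apply: tri_zero1_iso c'0 _; exists f, g, h.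
have {}sa := slice_iso (isomorphic_sym ic) sa.
move: phi1; rewrite le_eqVlt => /orP[/eqP ->//|lt].
apply: slice_zero; apply: hn_coaisle_hom0 hc _ cot _.
rewrite /unzip1 map_rcons all_rcons /= lt.
by apply: sub_all alK => x; exact: lt_trans.
Qed.

End StabilityAisle.

Section PhaseMin.
Variables (R : realType) (C : triangulated) (s : Stab R C).

Lemma hn_ofP c : hn (slice s) c (hn_of s c).
Proof. exact: projT2 (cid (slice_hn s c)). Qed.

(** A zero object has the empty filtration and [phase_min] the default value [0], hence the
    exclusion. *)
Lemma phase_min_all c x : ~ is_zero c ->
  all (fun y => x < y) (unzip1 (hn_of s c)) = (x < phase_min s c).
Proof.
move=> c0; rewrite /phase_min; case: (hn_ofP c) c0 => [{}c c0 /(_ c0)//|].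
move=> c' {}c a L phi f g h _ T sa a0 al _.
rewrite /unzip1 map_rcons all_rcons last_rcons /=; case: ltP => //= lt.
by rewrite all_map; apply: sub_all al => y /=; exact: lt_trans.
Qed.

Lemma aisle_phase_min D c : t_structure D -> stability_heart s = heart D ->
  ~ is_zero c -> D c <-> 0 < phase_min s c.
Proof. by move=> hD hs c0; rewrite (hn_aisle hD hs (hn_ofP c)) phase_min_all. Qed.

End PhaseMin.

Lemma closure_phase_min (R : realType) (C : triangulated) (sigma : Stab R C)
    (U : set (Stab R C)) (e : R) : closure U sigma -> 0 < e ->
  exists2 tau, U tau &
    forall c, ~ is_zero c -> `|phase_min sigma c - phase_min tau c| < e.
Proof.
move=> cl e0; have [tau [Utau Btau]] := cl _ (nbhsx_ballx sigma e e0).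
exists tau => // c c0; have lt : (stab_dist sigma tau < e%:E)%E := Btau.
rewrite -lte_fin; apply: le_lt_trans lt.
apply: (@le_trans _ _ (stab_gap sigma tau c)%:E).
  by rewrite lee_fin /stab_gap le_max lexx.
by apply: ereal_sup_ubound; exists c.
Qed.

(** * Tilting between nested aisles *)

Section Tilt.
Variables (C : triangulated) (D E : set C).
Hypotheses (hD : t_structure D) (hE : t_structure E).
Hypothesis DE : D `<=` E.
Hypothesis ED : E `<=` shift_down D.

Let T := heart D `&` shift_up E.

Let shift_upED : shift_up E `<=` D.
Proof.
by move=> X [W EW i]; case: (hD) => + _ _; apply; [exact: isomorphic_sym i|exact: ED].
Qed.

Let coaisle_sub : coaisle E `<=` coaisle D.
Proof. by move=> X oX Y [W DW i]; apply: oX; exists W => //; exact: DE. Qed.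

(** Truncation relative to [E[1]] stays in the heart of [D], since [E[1]] is contained in [D] and
    the coaisle of [E] in that of [D]. *)
Lemma tilt_sequence a : heart D a -> exists t f (i : Hom t a) (p : Hom a f) h,
  [/\ dist i p h, T t, heart D f & coaisle E f].
Proof.
move=> /heartP[Da coa].
have [V [H [[i [p [h Td]]] EV coH]]] := truncation_shift hE a.
have DV : D (shift V) by exact: ED.
have TV : tri (shift V) a H by exists i, p, h.
have DH : D H by exact: aisle_cone TV DV Da.
have coVH := coaisle_sub coH.
exists (shift V), H, i, p, h; split=> //; last exact/heartP.
split; last by exists V.
by apply/heartP => //; split=> //; exact: coaisle_fibre TV coa coVH.
Qed.

Lemma tilt_torsion_free a : heart D a -> orthr T a <-> coaisle E a.
Proof.
move=> Aa; split=> [oa|coa X [_ uX]]; last exact: coa.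
have [t [f [i [p [h [Td Tt _ cof]]]]]] := tilt_sequence Aa.
move=> X uX u; have [v ->] := dist_lift Td (cof _ uX (p \o u)).
by rewrite (oa _ Tt i) comp0m.
Qed.

Lemma tilt_torsion_theory : torsion_theory (heart D) T.
Proof.
split; first by move=> X [].
  move=> X Y i [AX uX]; split; first exact: heart_iso i AX.
  by case: uX => W EW j; exists W => //; apply: isomorphic_trans j; exact: isomorphic_sym.
move=> a Aa; have [t [f [i [p [h [Td Tt Af cof]]]]]] := tilt_sequence Aa.
exists t, f, i, p; split=> //; last exact/tilt_torsion_free.
by apply: heart_dist_short_exact Td _ Aa Af => //; case: Tt.
Qed.

Lemma heart_tilt : heart E = left_tilt (heart D) T.
Proof.
apply/seteqP; split=> [b /heartP[Eb cob]|b].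
  (* Truncating [b] relative to [D] exhibits it as an extension of [d'], in [T[-1]], by the
     torsion-free object [d]. *)
  have [d [d' [Tb Dd od']]] := truncation hD b.
  have [f [g [h Td]]] := Tb.
  have Ed' : E d' by apply: (aisle_cone hE Tb) => //; exact: DE.
  apply: ext_tri Td _ _; apply: ext_gen; [left|right].
    have Ad : heart D d.
      apply/heartP => //; split=> //; apply: (coaisle_fibre hD Tb).
        exact: coaisle_sub.
      exact: orthr_coaisle.
    split=> //; apply/tilt_torsion_free => //; apply: (coaisle_fibre hE Tb) => //.
    by move=> X /shift_upED; exact: od'.
  split; last by exists d'.
  by apply/heartP => //; split; [exact: ED|exact/coaisle_shift].
elim=> {b} [X [[AX]|[AX [W EW i]]]|X|X Y i _|X Y Z f g h Td _ AX _ AZ].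
- move=> /(tilt_torsion_free AX) coX; apply/heartP => //; split=> //.
  exact: DE (heart_aisle AX).
- apply/heartP => //; split.
    have iX : isomorphic W X by apply: isomorphic_sym; exact: (shift_iso _ _).2.
    by case: (hE) => + _ _ => /(_ _ _ iX); exact.
  have oX : orthr D X by apply: (coaisle_shift _ _).1; exact: heart_coaisle.
  by move=> Y /shift_upED; exact: oX.
- exact: heart_zero.
- exact: heart_iso.
- by apply: (heart_ext hE (X := X) (Z := Z)) => //; exists f, g, h.
Qed.

End Tilt.

(** * A point of the stratum *)

Section Stratum.
Variables (R : realType) (C : triangulated) (D : set C).
Hypothesis hD : t_structure D.
Hypothesis bD : bounded D.
Local Notation A := (heart D).
Hypothesis flA : finite_length A.
Hypothesis indA : finitely_many_indecomposables A.
Variables (k : nat) (s : 'I_k -> C).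
Hypothesis simple_s : forall i, simple_in A (s i).
Implicit Types X Y Z : C.

Definition is_marked X : bool := `[< exists i, isomorphic X (s i) >].

Lemma is_marked_iso X Y : isomorphic X Y -> is_marked X = is_marked Y.
Proof.
move=> i; apply/asboolP/asboolP => -[j ij]; exists j; last exact: isomorphic_trans i ij.
exact: isomorphic_trans (isomorphic_sym i) ij.
Qed.

Definition marked_weight X := weight D (fun Y => is_marked Y : nat) X.
Definition unmarked_weight X := weight D (fun Y => ~~ is_marked Y : nat) X.

Let marked_iso X Y : isomorphic X Y -> is_marked X = is_marked Y :> nat.
Proof. by move=> /is_marked_iso ->. Qed.

Let unmarked_iso X Y : isomorphic X Y -> ~~ is_marked X = ~~ is_marked Y :> nat.
Proof. by move=> /is_marked_iso ->. Qed.

Local Notation p := marked_weight.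
Local Notation q := unmarked_weight.

Lemma marked_tri X Y Z : tri X Y Z -> A X -> A Z -> p Y = (p X + p Z)%N.
Proof. exact: weight_tri. Qed.

Lemma unmarked_tri X Y Z : tri X Y Z -> A X -> A Z -> q Y = (q X + q Z)%N.
Proof. exact: weight_tri. Qed.

(** A nonzero object has a simple quotient, which counts 1 in exactly one of the two weights. *)
Lemma weights_gt0 X : A X -> ~ is_zero X -> (0 < p X + q X)%N.
Proof.
move=> AX X0; have [n j] := jh_exists hD flA (fun Y => is_marked Y : nat) AX.
have [Y [y [T AY sy]]] := jh_quotient hD j X0; have [Ay _ _] := sy.
rewrite (marked_tri T AY Ay) (unmarked_tri T AY Ay).
rewrite [p y]weight_simple // [q y]weight_simple //; case: (is_marked y) => /=; lia.
Qed.

Lemma unmarked_weight0 X : A X -> q X = 0%N -> ext_closure (range s) X.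
Proof.
move=> AX; have := jh_weight hD flA unmarked_iso AX; rewrite -/(q X) => j; move: j.
move: (q X) => n; elim=> {X AX n} [X X0 _|X' X y n [f [g [h T]]] _ _ IH /eqP].
  exact: ext_zero.
rewrite addn_eq0 => /andP[/eqP/IH eX']; rewrite eqb0 negbK => /asboolP[i iy].
apply: ext_tri T eX' _; apply: ext_iso (isomorphic_sym iy) _.
by apply: ext_gen; exists i.
Qed.

Lemma stratum_point : exists2 sigma : Stab R C, stab_stratum A s sigma &
  forall X, A X -> slice sigma 1 X -> ext_closure (range s) X.
Proof.
pose lam X : R[i] := (- (p X)%:R +i* (q X)%:R)%C.
have lam_tri X Y Z : tri X Y Z -> A X -> A Z -> lam Y = lam X + lam Z.
  move=> T AX AZ; rewrite /lam (marked_tri T) // (unmarked_tri T) // !natrD opprD.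
  by apply/eqP; rewrite eq_complex /= !eqxx.
have chi_tri := euler_tri hD bD lam_tri.
have chi_heart := euler_heart hD bD lam_tri.
have [Z HZ] := k0_universal chi_tri.
have charge phi X : slicing D p q phi X -> ~ is_zero X ->
    exists2 m : R, 0 < m & Z (k0_class X) = (m%:C * expipi phi)%C.
  by rewrite HZ; apply: slicing_charge => //; exact: weights_gt0.
have biprod (phi : R) X Y S : is_biproduct X Y S -> slicing D p q phi X ->
    slicing D p q phi Y -> slicing D p q phi S.
  by move=> /tri_biproduct; exact: (slicing_ext hD marked_tri unmarked_tri).
pose sigma0 := @Stability R C Z (slicing D p q) (fun phi => @slicing_iso R C D p q phi)
  (slicing_zero hD marked_tri unmarked_tri) biprod charge
  (slicing_shift_up D p q) (slicing_hom0 hD marked_tri unmarked_tri weights_gt0)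
  (slicing_hn R hD bD marked_tri unmarked_tri weights_gt0).
have lf : locally_finite sigma0.
  exact: (slicing_locally_finite R hD flA indA marked_tri unmarked_tri weights_gt0).
have h1 : 0 < (1 : R) <= 1 by rewrite ltr01 lexx.
(* So phase 1 means that no unmarked composition factor occurs; dually [theta] at phase 1/2 is [p],
   and unmarked simple objects get phase 1/2. *)
have q1 X : theta p q 1 X = - (q X)%:R :> R.
  by rewrite /theta mulr1 sinpi cospi mulr0 add0r mulrN1.
exists (MkStab lf); last first.
  move=> X AX /(slicing_heart hD marked_tri unmarked_tri X h1)[_ _ tX _].
  by apply: unmarked_weight0 => //; move/eqP: tX; rewrite q1 oppr_eq0 pnatr_eq0 => /eqP.
split.
- exact: (slicing_generates_heart R hD marked_tri unmarked_tri weights_gt0).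
- move=> i; have [Ai _ _] := simple_s i.
  apply/(slicing_heart hD marked_tri unmarked_tri _ h1).
  have qi : q (s i) = 0%N.
    rewrite [LHS]weight_simple // /is_marked; apply/eqP; rewrite eqb0 negbK.
    by apply/asboolP; exists i.
  split=> //; first by rewrite q1 qi oppr0.
  move=> Y [K [AK AY T]]; rewrite q1.
  have := unmarked_tri T AK AY; rewrite qi => /esym/eqP.
  by rewrite addn_eq0 => /andP[_ /eqP ->]; rewrite oppr0.
move=> y sy nys; have [Ay _ _] := sy; exists (2^-1).
  by rewrite invr_gt0 ltr0n invf_lt1 ?ltr0n // ltr1n.
have h2 : 0 < (2^-1 : R) <= 1 by rewrite invr_gt0 ltr0n invf_le1 ?ltr0n // ler1n.
have p2 X : theta p q 2^-1 X = (p X)%:R :> R.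
  by rewrite /theta sin_pihalf cos_pihalf mulr1 mulr0 addr0.
apply/(slicing_heart hD marked_tri unmarked_tri _ h2); split=> //;
  last by move=> Y _; rewrite p2.
rewrite p2 [p y]weight_simple // /is_marked; case: asboolP => // -[i iy].
by case: (nys i).
Qed.

End Stratum.

Theorem corollary2p16 (R : realType) (C : triangulated) (A : set C)
  (hA : is_heart A)
  (hfl : forall A' : set C, simple_tilts A A' -> finite_length A')
  (hind : forall A' : set C, simple_tilts A A' -> finitely_many_indecomposables A')
  (k : nat) (s : 'I_k -> C)
  (hs : forall i, simple_in A (s i))
  (hdist : forall i j, i <> j -> ~ isomorphic (s i) (s j))
  (B : set C) (hB : is_heart B)
  (hS : stab_stratum A s `<=`
        stab_with_heart A `&` closure (stab_with_heart B : set (Stab R C))) :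
  exists T : set C,
    [/\ torsion_theory A T, T `<=` ext_closure (range s) & B = left_tilt A T].
Proof.
case: hA hfl hind hs hS => D [hD bD ->] hfl hind hs hS.
case: hB hS => E [hE _ ->] hS.
have [sigma strat slice1] :=
  stratum_point R hD bD (hfl _ (simple_tilts0 _)) (hind _ (simple_tilts0 _)) hs.
have [sD cl] := hS _ strat.
have DE : D `<=` E.
  move=> c Dc; have [c0|c0] := pselect (is_zero c); first exact: aisle_zero.
  have m0 := (aisle_phase_min hD sD c0).1 Dc.
  (* The approximation [tau] is chosen after [c], within the positive distance of its minimal phase
     from 0. *)
  have [tau sE] := closure_phase_min cl m0 => /(_ c c0); rewrite ltr_norml => near.
  apply/(aisle_phase_min hE sE c0); lra.
(* The limit only preserves the weak inequality, which is why [E] lies in [D[-1]] but not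
   necessarily in [D]. *)
have minE c : E c -> ~ is_zero c -> 0 <= phase_min sigma c.
  move=> Ec c0; rewrite leNgt; apply/negP => m0.
  have [|tau sE] := @closure_phase_min _ _ _ _ (- phase_min sigma c) cl.
    by rewrite oppr_gt0.
  move=> /(_ c c0); rewrite ltr_norml => near.
  by have := (aisle_phase_min hE sE c0).1 Ec; lra.
have hnE c : E c -> ~ is_zero c -> forall x, x < 0 ->
    all (fun y => x < y) (unzip1 (hn_of sigma c)).
  by move=> Ec c0 x x0; rewrite phase_min_all // (lt_le_trans x0) // minE.
have ED : E `<=` shift_down D.
  move=> c Ec; have [c0|c0] := pselect (is_zero c).
    by apply: (aisle_zero hD); exact: (is_zero_shift _).2.
  have [L hL EL] := hn_shift (slice_shiftP sigma) (hn_ofP sigma c).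
  apply/(hn_aisle hD sD hL); rewrite EL all_map.
  (* A phase of [c[1]] is positive as soon as that of [c] exceeds -1. *)
  apply: sub_all (hnE c Ec c0 (-1) _) => [x /=|]; lra.
exists (heart D `&` shift_up E); split.
- exact: tilt_torsion_theory.
- move=> t [At [d Ed it]]; apply: slice1 => //.
  have [d0|d0] := pselect (is_zero d).
    apply: slice_zero; apply: is_zero_iso (isomorphic_sym it) _.
    exact: (is_zero_shift _).2.
  by apply: (heart_phase1 hD sD At it (hn_ofP sigma d)); exact: hnE.
exact: heart_tilt.
Qed.
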